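(* Let $d\ge 1$, $N\ge 1$, $n\ge 1$ and $1\le m\le \min(d,N)$ be integers, let $\alpha\ge -\frac12$ be real, and let $X_1,\dots,X_n$ be i.i.d. random vectors with values in $I^d=[-1,1]^d$ and common density $\boldsymbol g_\alpha(\boldsymbol x)=\big(h_0^{(\alpha)}\big)^{-d}\prod_{i=1}^d(1-x_i^2)^\alpha\,\mathbf 1_{I^d}(\boldsymbol x)$. Let $G_{N,n,m}^{(\alpha)}$ be the $M_{N,m,d}\times M_{N,m,d}$ random matrix with entries $$G_{N,n,m}^{(\alpha)}(i,j)=\frac{\big(h_0^{(\alpha)}\big)^d}{n}\sum_{p=1}^n\Psi_i^{(\alpha)}(X_p)\Psi_j^{(\alpha)}(X_p),\qquad 1\le i,j\le M_{N,m,d}.$$ Then for every $0<\delta<1$, $$\mathbb P\left(\kappa_2\big(G_{N,n,m}^{(\alpha)}\big)\le\frac{1+\delta}{1-\delta}\right)\ \ge\ 1-2\,M_{N,m,d}\,\exp\left(-\delta^2\,\frac{n}{3\,D(N,\alpha)^{2m}\,M_{N,m,d}}\right).$$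
   Context: For real $\alpha\ge-\frac12$ let $w_\alpha(x)=(1-x^2)^\alpha$ on $I=[-1,1]$, and let $\widetilde P_k^{(\alpha)}$ ($k\ge0$) be the normalized Jacobi polynomial of degree $k$ with parameters $(\alpha,\alpha)$, so that $\int_{-1}^1\widetilde P_j^{(\alpha)}\widetilde P_k^{(\alpha)}w_\alpha\,dx=\delta_{j,k}$ (positive leading coefficient). Let $h_0^{(\alpha)}=\int_{-1}^1 w_\alpha=2^{2\alpha+1}\mathrm B(\alpha+1,\alpha+1)$, with $\mathrm B$ the Beta function; thus $\widetilde P_0^{(\alpha)}=1/\sqrt{h_0^{(\alpha)}}$. Let $\mathcal D=\{1,\dots,d\}$. For $\boldsymbol u\subset\mathcal D$ with cardinality $|\boldsymbol u|\ge1$ and $\boldsymbol k\in\mathbb N_0^d$ with $k_j\ge1$ for $j\in\boldsymbol u$ and $k_j=0$ for $j\notin\boldsymbol u$, put $$\Phi^{(\alpha)}_{\boldsymbol u,\boldsymbol k}(\boldsymbol x)=\big(h_0^{(\alpha)}\big)^{-(d-|\boldsymbol u|)/2}\prod_{i\in\boldsymbol u}\widetilde P^{(\alpha)}_{k_i}(x_i),$$ and put $\Phi^{(\alpha)}_{\boldsymbol 0}=\big(h_0^{(\alpha)}\big)^{-d/2}$. Let $\Psi_1^{(\alpha)},\dots,\Psi^{(\alpha)}_{M_{N,m,d}}$ be an enumeration (in any fixed order) of $\Phi^{(\alpha)}_{\boldsymbol 0}$ and all the $\Phi^{(\alpha)}_{\boldsymbol u,\boldsymbol k}$ with $1\le|\boldsymbol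 u|\le m$ and $\|\boldsymbol k\|_1=\sum_j k_j\le N$; their number is $$M_{N,m,d}=\sum_{k=0}^m\binom dk\binom Nk.$$ Let $D(N,\alpha)=\pi^{3/4}N^{\alpha+\frac12}e^{\alpha+\frac34}$ if $\alpha>-\frac12$, and $D(N,-\frac12)=2$. For a symmetric positive semidefinite matrix $G$, $\kappa_2(G)=\lambda_{\max}(G)/\lambda_{\min}(G)$ is the 2-norm condition number, understood as $+\infty$ if $\lambda_{\min}(G)=0$. *)

(* Defs.v *)
From HB Require Import structures.
From mathcomp Require Import all_boot all_order all_algebra.
From mathcomp Require Import all_classical all_reals all_analysis.
Set Implicit Arguments.
Unset Strict Implicit.
Unset Printing Implicit Defensive.
Import Order.TTheory GRing.Theory Num.Theory.
Import numFieldNormedType.Exports.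
Local Open Scope classical_set_scope.
Local Open Scope ring_scope.

Section jacobi.
Context {R : realType}.

(* At x = 1 and x = -1 with alpha < 0 this is 0 (a totalization of powR); the
   two points are Lebesgue-null. *)
Definition jacobi_weight (alpha x : R) : R := (1 - x ^+ 2) `^ alpha.

Definition jacobi_h0 (alpha : R) : R :=
  \int[lebesgue_measure]_(x in `[(-1 : R), 1]) jacobi_weight alpha x.

(* The classical Jacobi polynomial P_k^(a,b), in the form
   1/k! sum_v 'C(k,v) (k+a+b+1)...(k+a+b+v) (a+v+1)...(a+k) ((x-1)/2)^v
   (Szego, Orthogonal Polynomials, (4.21.2)), which involves no division by an
   expression in a, b. *)
Definition jacobi (a b : R) (k : nat) : {poly R} :=
  (k`!%:R)^-1 *: \sum_(v < k.+1)
    ('C(k, v)%:R * (\prod_(1 <= i < v.+1) (k%:R + a + b + i%:R))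
                 * (\prod_(v.+1 <= i < k.+1) (a + i%:R)))
    *: (2^-1 *: ('X - 1)) ^+ v.

(* Dividing by the weighted L^2 norm gives the orthonormal family; the leading
   coefficient of [jacobi alpha alpha k] is positive for -1/2 <= alpha. *)
Definition njacobi (alpha : R) (k : nat) : {poly R} :=
  (Num.sqrt (\int[lebesgue_measure]_(x in `[(-1 : R), 1])
     ((jacobi alpha alpha k).[x] ^+ 2 * jacobi_weight alpha x)))^-1
  *: jacobi alpha alpha k.

End jacobi.

Section tensor_basis.
Context {R : realType} {d : nat}.
Implicit Types (u : {set 'I_d}) (k : {ffun 'I_d -> nat}) (x : d.-tuple R).

(* For u empty this is the constant h0^(-d/2). *)
Definition Phi (alpha : R) u k x : R :=
  jacobi_h0 alpha `^ (- (d%:R - #|u|%:R) / 2)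
  * \prod_(i in u) (njacobi alpha (k i)).[tnth x i].

End tensor_basis.

(* The pairs (u, k) with u the support of k; the pair (empty set, 0) indexes
   the constant basis function. *)
Definition basis_index (d N m : nat) :
    set ({set 'I_d} * {ffun 'I_d -> nat}) :=
  [set uk : {set 'I_d} * {ffun 'I_d -> nat} |
    [/\ (forall j, j \in uk.1 -> 1 <= uk.2 j)%N,
        (forall j, j \notin uk.1 -> uk.2 j = 0%N),
        (#|uk.1| <= m)%N &
        (\sum_(j < d) uk.2 j <= N)%N]].

Arguments basis_index d N m _ : clear implicits.

Definition basis_dim (d N m : nat) : nat :=
  (\sum_(0 <= k < m.+1) 'C(d, k) * 'C(N, k))%N.

Definition Psi (R : realType) (d M : nat) (alpha : R)
    (e : 'I_M -> {set 'I_d} * {ffun 'I_d -> nat}) (i : 'I_M)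
    (x : d.-tuple R) : R :=
  Phi alpha (e i).1 (e i).2 x.

Definition gram (R : realType) (d M n : nat) (alpha : R)
    (e : 'I_M -> {set 'I_d} * {ffun 'I_d -> nat}) (x : 'I_n -> d.-tuple R) :
    'M[R]_M :=
  \matrix_(i, j) (jacobi_h0 alpha ^+ d / n%:R
    * \sum_(p < n) Psi alpha e i (x p) * Psi alpha e j (x p)).

Definition Dconst (R : realType) (N : nat) (alpha : R) : R :=
  if alpha == - 2^-1 then 2
  else pi `^ (3 / 4) * N%:R `^ (alpha + 2^-1) * expR (alpha + 3 / 4).

Section condition_number.
Context {R : realType} {M : nat}.
Implicit Type A : 'M[R]_M.

Definition lambda_max A : R := sup [set a : R | eigenvalue A a].
Definition lambda_min A : R := inf [set a : R | eigenvalue A a].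

(* Meant for A symmetric positive semidefinite, where the eigenvalues are the
   singular values. *)
Definition cond2 A : \bar R :=
  if lambda_min A == 0 then +oo%E else (lambda_max A / lambda_min A)%:E.

End condition_number.

Section lebesgue_tuple.
Context {R : realType}.

Definition tcons (n : nat) (tx : n.-tuple R * R) : n.+1.-tuple R :=
  [the n.+1.-tuple R of tx.2 :: tx.1].

Lemma measurable_tcons n : measurable_fun setT (@tcons n).
Proof. exact: measurable_cons. Qed.

Section cons_measure.
Context (n : nat) (mu : {measure set (n.-tuple R) -> \bar R}).

Definition cons_measure : set (n.+1.-tuple R) -> \bar R :=
  pushforward (mu \x lebesgue_measure)%E (@tcons n).

Let cons_measure0 : cons_measure set0 = 0%E.
Proof. by rewrite /cons_measure /pushforward preimage_set0 measure0. Qed.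

Let cons_measure_ge0 A : (0 <= cons_measure A)%E.
Proof. exact: measure_ge0 (mu \x lebesgue_measure)%E _. Qed.

Let cons_measure_sigma_additive : semi_sigma_additive cons_measure.
Proof.
have := @measure_semi_sigma_additive _ _ _
  (pushforward (mu \x lebesgue_measure)%E (@tcons n)).
by apply; exact: measurable_tcons.
Qed.

HB.instance Definition _ := isMeasure.Build _ _ _ cons_measure
  cons_measure0 cons_measure_ge0 cons_measure_sigma_additive.

End cons_measure.

(* Lebesgue measure on R^n: the n-fold product of [lebesgue_measure], carried
   to tuples; on R^0 it is the unit mass at the only point. *)
Fixpoint lebesgue_tuple (n : nat) : {measure set (n.-tuple R) -> \bar R} :=
  match n with
  | 0 => dirac [tuple of [::]]
  | n'.+1 => cons_measure (lebesgue_tuple n')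
  end.

Definition cube (d : nat) : set (d.-tuple R) :=
  [set x | forall i, -1 <= tnth x i <= 1].
Arguments cube d _ : clear implicits.

Definition jacobi_density (d : nat) (alpha : R) (x : d.-tuple R) : R :=
  (jacobi_h0 alpha ^+ d)^-1 * (\prod_(i < d) jacobi_weight alpha (tnth x i))
  * \1_(cube d) x.

End lebesgue_tuple.
Arguments cube {R} d _.

Section random_vectors.
Context d d' (T : measurableType d) (T' : measurableType d') (R : realType)
  (P : probability T R).

Definition mutually_independent (n : nat) (X : 'I_n -> {RV P >-> T'}) : Prop :=
  forall (J : {set 'I_n}) (A : 'I_n -> set T'),
    (forall i, i \in J -> measurable (A i)) ->
    P (\bigcap_(i in [set` J]) (X i @^-1` A i))
    = (\prod_(i in J) P (X i @^-1` A i))%E.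

Definition has_density (mu : {measure set T' -> \bar R}) (X : {RV P >-> T'})
    (g : T' -> R) : Prop :=
  forall A, measurable A -> distribution P X A = (\int[mu]_(x in A) (g x)%:E)%E.

End random_vectors.

(* Main.v *)
(** Let [v_p] be the column of the values of the basis at the [p]-th sample,
    scaled so that [E (v_p v_p^T) = I]; then the Gram matrix is
    [G = (1/n) sum_p v_p v_p^T] and [|v_p|^2 <= L = D^(2m) M].  The eigenvalues
    of [G] are controlled by a matrix Chernoff bound in which the matrix
    exponential is replaced by the polynomial [tr ((I + (eta/k) S)^k)], where
    [S = sum_p v_p v_p^T], [k] is even and large, and [eta] has either sign.
    When a rank-one term is switched on along [Q + t (eta/k) v v^T], the
    derivatives of this trace are sums of products of the moments
    [v^T Q^i v], which are log-convex in [i]; a Gronwall argument then bounds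
    the new trace by the old one plus a multiple of [v^T Q^(k-1) v], and
    independence turns the latter into [tr (Q^(k-1))] in expectation.

    The bound on [|v_p|^2] comes from [h_0 P_k(x)^2 <= h_0 P_k(1)^2] (Sonin's
    function) and the value of [h_0 P_k(1)^2 / |P_k|^2], obtained by induction
    on [k] from [P_k^(a)' = (k+2a+1)/2 P_(k-1)^(a+1)] and integration by parts
    against the weight.  The measurability of the event follows from the
    Rayleigh quotients over rational vectors. *)
Require Import Defs.
From HB Require Import structures.
From mathcomp Require Import all_boot all_order all_algebra.
From mathcomp Require Import all_classical all_reals all_analysis.
From mathcomp Require Import measurable_realfun.
From mathcomp Require Import ring lra zify.
Set Implicit Arguments.
Unset Strict Implicit.
Unset Printing Implicit Defensive.
Import Order.TTheory GRing.Theory Num.Theory.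
Import numFieldNormedType.Exports.
Local Open Scope classical_set_scope.
Local Open Scope ring_scope.

(** * Quadratic forms *)

(** The usual proof of a matrix Chernoff bound needs a trace inequality for the exponential of a sum
    of non-commuting matrices. For a power, cyclicity gives the derivative of the trace exactly, and
    Cauchy-Schwarz for quadratic forms does the rest, without diagonalisation. An even exponent
    makes the trace a squared Frobenius norm, hence nonnegative and at least the same power of each
    eigenvalue. No limit in the exponent [K] is taken. Two errors remain: the perturbed identity is
    bounded below by some [r < 1] instead of 1, and [(1 + y/K)^K] replaces [e^y]. The step
    [eta = s (3/5) delta / L], with [s] the sign of the tail, gives about 0.341 in place of the
    required 1/3, and [K] is taken so large that the errors fit into the difference. On the Jacobi
    side no Beta or Gamma function is evaluated: norms, values at 1 and [jacobi_h0] are related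
    between the parameters [a] and [a + 1], with [jacobi_h0] kept as a symbol. *)

Section dot.
Context {R : realType} {M : nat}.
Implicit Types (u v x y : 'cV[R]_M) (A B : 'M[R]_M).
Definition dot u v : R := \sum_i u i 0 * v i 0.
Lemma dotC u v : dot u v = dot v u.
Proof. by apply: eq_bigr => i _; rewrite mulrC. Qed.
Lemma dotDr u v x : dot u (v + x) = dot u v + dot u x.
Proof. by rewrite -big_split; apply: eq_bigr => i _; rewrite !mxE mulrDr. Qed.
Lemma dotZr u c v : dot u (c *: v) = c * dot u v.
Proof. by rewrite mulr_sumr; apply: eq_bigr => i _; rewrite !mxE mulrCA. Qed.
Lemma dotDl u v x : dot (v + x) u = dot v u + dot x u.
Proof. by rewrite dotC dotDr !(dotC u). Qed.
Lemma dotZl u c v : dot (c *: v) u = c * dot v u.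
Proof. by rewrite dotC dotZr (dotC u). Qed.
Lemma dot_ge0 u : 0 <= dot u u.
Proof. by apply: sumr_ge0 => i _; rewrite -expr2 sqr_ge0. Qed.
Lemma dot_eq0 u : (dot u u == 0) = (u == 0).
Proof.
apply/idP/idP => [|/eqP ->]; last by rewrite /dot big1// => i _; rewrite mxE mul0r.
rewrite psumr_eq0 => [/allP h|i _]; last by rewrite -expr2 sqr_ge0.
apply/eqP/matrixP => i j; rewrite ord1 mxE.
by have := h i (mem_index_enum _); rewrite /= mulf_eq0 orbb => /eqP.
Qed.
Lemma dot_tr A u v : dot u (A *m v) = dot (A^T *m u) v.
Proof.
rewrite /dot; under eq_bigr do rewrite mxE mulr_sumr.
rewrite exchange_big/=; apply: eq_bigr => j _.
rewrite mxE mulr_suml; apply: eq_bigr => i _; rewrite mxE; ring.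
Qed.
Definition psd A := A^T = A /\ forall x, 0 <= dot x (A *m x).
(** Discriminant of the nonnegative quadratic in [s] given by the form at [u + s v]; when [c = 0]
    this function is affine, which forces [b = 0]. *)
Lemma psd_CS A u v : psd A ->
  dot u (A *m v) ^+ 2 <= dot u (A *m u) * dot v (A *m v).
Proof.
move=> [sA pA].
set a := dot u (A *m u); set b := dot u (A *m v); set c := dot v (A *m v).
have q s : 0 <= c * s ^+ 2 + (2 * b) * s + a.
  have := pA (u + s *: v).
  rewrite mulmxDr -scalemxAr !(dotDr, dotDl, dotZr, dotZl).
  rewrite (_ : dot v (A *m u) = b); last by rewrite dot_tr sA dotC.
  rewrite -/a -/b -/c => h; apply: le_trans h _; rewrite le_eqVlt; apply/orP; left; apply/eqP; ring.
have [c0|c0] := eqVneq c 0.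
  have [->|b0] := eqVneq b 0; first by rewrite expr0n mulr_ge0 ?pA.
  (* At this point the affine function takes the value -1. *)
  have := q (- (a + 1) / (2 * b)).
  have -> : 2 * b * (- (a + 1) / (2 * b)) = - (a + 1) by field.
  by rewrite c0 mul0r; lra.
have cp : 0 < c by rewrite lt_def c0 pA.
have := q (- b / c).
rewrite -(ler_pM2l cp) mulr0.
have -> : c * (c * (- b / c) ^+ 2 + 2 * b * (- b / c) + a) = c * a - b ^+ 2.
  by field.
by rewrite subr_ge0 mulrC.
Qed.
Lemma dot_CS u v : dot u v ^+ 2 <= dot u u * dot v v.
Proof.
have := @psd_CS 1%:M u v; rewrite !mul1mx; apply; split; first by rewrite trmx1.
by move=> x; rewrite mul1mx dot_ge0.
Qed.
End dot.

(** * Traces of powers and eigenvalues *)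

Section frobenius.
Context {R : realType} {M : nat}.
Implicit Types (u v x y : 'cV[R]_M) (A B : 'M[R]_M).
Lemma dot_mulmxT A u v : A^T = A -> dot u (A *m v) = dot (A *m u) v.
Proof. by move=> sA; rewrite dot_tr sA. Qed.
Lemma trmx_exp A k : (A ^+ k)^T = A^T ^+ k.
Proof.
elim: k => [|k IH]; first by rewrite !expr0 trmx1.
by rewrite exprS exprSr trmx_mul IH.
Qed.
Lemma mxtrace_rank1 A v : \tr (A *m (v *m v^T)) = dot v (A *m v).
Proof.
rewrite mulmxA mxtrace_mulC /dot /mxtrace big_ord1 mxE.
by apply: eq_bigr => i _; rewrite mxE.
Qed.
Lemma mxtrace_sqr_ge0 A : A^T = A -> 0 <= \tr (A ^+ 2).
Proof.
move=> sA; apply: sumr_ge0 => i _; rewrite expr2 -{1}sA mxE.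
by apply: sumr_ge0 => j _; rewrite mxE -expr2 sqr_ge0.
Qed.
Lemma dot_le_frob A v : A^T = A -> dot (A *m v) (A *m v) <= \tr (A ^+ 2) * dot v v.
Proof.
move=> sA; rewrite /mxtrace mulr_suml /dot; apply: ler_sum => i _.
have := dot_CS (A^T *m delta_mx i 0) v.
rewrite -dot_tr.
have E w : dot (delta_mx i 0) w = w i 0.
  rewrite /dot (bigD1 i)//= big1 ?addr0 ?mxE ?eqxx ?mul1r// => j ji.
  by rewrite mxE (negbTE ji) mul0r.
rewrite E expr2; congr (_ <= _ * _).
have F j : (A^T *m delta_mx i 0 : 'cV[R]_M) j 0 = A i j.
  rewrite mxE (bigD1 i)//= big1 ?addr0 => [|l li]; first by rewrite !mxE !eqxx mulr1.
  by rewrite !mxE (negbTE li) mulr0.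
rewrite /dot expr2 mxE; apply: eq_bigr => j _; rewrite F.
by congr (_ * _); rewrite -[in LHS]sA mxE.
Qed.
(** For an eigenvector [v], [a^(2k) |v|^2 = |A^k v|^2], and the squared Frobenius norm of the
    symmetric matrix [A^k] is [tr (A^(2k))]. This replaces the formula for the trace as a sum over
    the spectrum. *)
Lemma eigenvalue_le_mxtrace A (a : R) k v : A^T = A -> v != 0 -> A *m v = a *: v ->
  a ^+ (k.*2) <= \tr (A ^+ k.*2).
Proof.
move=> sA v0 Av.
have E : A ^+ k *m v = a ^+ k *: v.
  elim: k => [|k IH]; first by rewrite !expr0 mul1mx scale1r.
  by rewrite exprSr -mulmxA Av -scalemxAr IH scalerA -exprS.
have vp : 0 < dot v v by rewrite lt_def dot_eq0 v0 dot_ge0.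
rewrite -(ler_pM2r vp) -muln2 !exprM.
apply: le_trans (dot_le_frob _ _); last by rewrite trmx_exp sA.
by rewrite E dotZl dotZr mulrA expr2.
Qed.
End frobenius.

(** * Moments of a positive definite matrix *)

(** Log-convexity makes the ratios [a (i+1) / a i] nondecreasing ([mono], cross-multiplied). Then
    [a j / a 0], the product of the first [j] ratios, is at most [a (i+j) / a i], the product of the
    [j] ratios from [i] on. *)
Lemma log_convex_superadd (R : realFieldType) (a : nat -> R) :
  (forall i, 0 < a i) -> (forall i, a i.+1 ^+ 2 <= a i * a i.+2) ->
  forall i j, a i * a j <= a 0%N * a (i + j)%N.
Proof.
move=> a0 alc.
have mono i j : a i.+1 * a (i + j)%N <= a i * a (i + j).+1.
  elim: j => [|j IH]; first by rewrite addn0 mulrC.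
  rewrite addnS -(ler_pM2r (a0 (i + j)%N)) mulrAC.
  apply: le_trans (_ : a i * a (i + j).+1 * a (i + j).+1 <= _).
    by rewrite ler_pM2r.
  by rewrite -!mulrA ler_pM2l// -expr2 [leRHS]mulrC.
move=> i; elim=> [|j IH]; first by rewrite addn0 mulrC.
rewrite addnS -(ler_pM2r (a0 j)) mulrAC.
apply: le_trans (_ : a 0%N * a (i + j)%N * a j.+1 <= _).
  by rewrite ler_pM2r.
rewrite -!mulrA ler_pM2l// [_ * a j]mulrC.
by have := mono j i; rewrite addnC [a j.+1 * _]mulrC.
Qed.

Lemma mxexprS (R : pzRingType) M (A : 'M[R]_M) k : A ^+ k.+1 = A *m A ^+ k.
Proof. exact: exprS. Qed.

Section moments.
Context {R : realType} {M : nat}.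
Implicit Types (u v x y : 'cV[R]_M) (A B : 'M[R]_M).
Definition ge_scalar (r : R) B := B^T = B /\ forall x, r * dot x x <= dot x (B *m x).
(** The [i]-th moment of the spectral measure of [B] at [v]. *)
Definition moment B v i : R := dot v (B ^+ i *m v).

Lemma ge_scalar_psd r B : 0 <= r -> ge_scalar r B -> psd B.
Proof.
by move=> r0 [sB hB]; split=> // x; apply: le_trans (hB x); rewrite mulr_ge0 ?dot_ge0.
Qed.

Lemma moment_add B v i j : B^T = B ->
  moment B v (i + j) = dot (B ^+ i *m v) (B ^+ j *m v).
Proof.
by move=> sB; rewrite /moment exprD -mulmxA dot_mulmxT ?trmx_exp ?sB.
Qed.

Context (r : R) (B : 'M[R]_M) (r0 : 0 < r) (hB : ge_scalar r B).
Let sB : B^T = B := hB.1.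
Let pB : psd B := ge_scalar_psd (ltW r0) hB.

Let exp_neq0 v l : v != 0 -> B ^+ l *m v != 0.
Proof.
move=> v0; elim: l => [|l IH]; first by rewrite expr0 mul1mx.
apply: contraNneq IH => E; rewrite -dot_eq0 eq_le dot_ge0 andbT.
rewrite -(ler_pM2l r0) mulr0; apply: le_trans (hB.2 _) _.
by rewrite mulmxA -mxexprS E /dot big1// => i _; rewrite !mxE mulr0.
Qed.

Lemma moment_odd v l : moment B v l.*2.+1 = dot (B ^+ l *m v) (B *m (B ^+ l *m v)).
Proof. by rewrite -addnn -addSn moment_add// dotC mxexprS -mulmxA. Qed.

Lemma moment_even v l : moment B v l.*2 = dot (B ^+ l *m v) (B ^+ l *m v).
Proof. by rewrite -addnn moment_add. Qed.

Lemma moment_odd_ge v l : r * moment B v l.*2 <= moment B v l.*2.+1.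
Proof. by rewrite moment_odd moment_even; exact: hB.2. Qed.

Lemma moment_gt0 v i : v != 0 -> 0 < moment B v i.
Proof.
move=> v0.
have P l : 0 < moment B v l.*2 by rewrite moment_even lt_def dot_eq0 exp_neq0//= dot_ge0.
rewrite -(odd_double_half i); case: (odd i); last exact: P.
by rewrite add1n (lt_le_trans _ (moment_odd_ge _ _))// mulr_gt0// P.
Qed.

Lemma moment_ge0 v i : 0 <= moment B v i.
Proof.
have [->|v0] := eqVneq v 0; last exact/ltW/moment_gt0.
by rewrite /moment mulmx0 /dot big1// => j _; rewrite mxE mul0r.
Qed.

(** Cauchy-Schwarz for [B^l v] and [B^(l+1) v]. To avoid a square root of [B], the parity of [i]
    selects the form: the one given by [B] for odd [i], plain [dot] for even [i]. *)
Lemma moment_log_convex v i : moment B v i.+1 ^+ 2 <= moment B v i * moment B v i.+2.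
Proof.
rewrite -(odd_double_half i); case: (odd i) => /=; set l := i./2.
  have := psd_CS (B ^+ l *m v) (B ^+ l.+1 *m v) pB.
  rewrite -!moment_odd -doubleS; congr (_ ^+ 2 <= _ * _).
  by rewrite [in RHS]doubleS -addnn -addnS -addSn moment_add// dot_mulmxT// mulmxA -mxexprS.
have := dot_CS (B ^+ l *m v) (B ^+ l.+1 *m v).
by rewrite -!moment_even -moment_add// addnS addnn.
Qed.

Lemma moment_mul_le v i j : moment B v i * moment B v j <= moment B v 0 * moment B v (i + j).
Proof.
have [->|v0] := eqVneq v 0; first by rewrite /moment !mulmx0 /dot big1 ?mul0r// => k _; rewrite mxE mul0r.
apply: log_convex_superadd => k; [exact: moment_gt0|exact: moment_log_convex].
Qed.
End moments.

(** * Derivatives of matrix powers *)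

Section matrix_derivative.
Context {R : realType} {M : nat}.
Implicit Types (F G : R -> 'M[R]_M) (DF DG : 'M[R]_M).
Definition is_mxderive (t : R) F DF : Prop :=
  forall i j, is_derive t (1 : R) (fun s => F s i j : R) (DF i j).

Lemma is_mxderive_mul t F G DF DG : is_mxderive t F DF -> is_mxderive t G DG ->
  is_mxderive t (fun s => F s * G s) (DF * G t + F t * DG).
Proof.
move=> dF dG i j.
rewrite (_ : (fun s => _) = \sum_k ((fun s => F s i k) * (fun s => G s k j))); last first.
  by apply/funext => s; rewrite mxE fct_sumE.
apply: is_derive_eq; first by apply: is_derive_sum => k; apply: is_deriveM.
rewrite !mxE -big_split; apply: eq_bigr => k _ /=.
by rewrite addrC; congr (_ + _); rewrite /GRing.scale/= mulrC.
Qed.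

(** [F] and [DF] need not commute, so the power rule stays a sum. Under the trace its terms coincide
    by cyclicity; in the quadratic form of [v], with [DF] of rank one, each term becomes a product
    of two moments. *)
Lemma is_mxderive_exp t F DF k : is_mxderive t F DF ->
  is_mxderive t (fun s => F s ^+ k) (\sum_(i < k) F t ^+ i * DF * F t ^+ (k.-1 - i)).
Proof.
move=> dF; elim: k => [|k IH].
  rewrite big_ord0 => i j; under eq_fun do rewrite expr0.
  by rewrite [X in is_derive _ _ _ X]mxE; exact: is_derive_cst.
under [X in is_mxderive _ X]eq_fun do rewrite exprS.
rewrite big_ord_recl expr0 mul1r subn0 /=.
rewrite (_ : \sum_i _ = F t * \sum_(i < k) F t ^+ i * DF * F t ^+ (k.-1 - i)).
  exact: is_mxderive_mul.
rewrite mulr_sumr; apply: eq_bigr => i _; rewrite exprS !mulrA.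
by congr (_ * _ ^+ _); rewrite /bump/=; lia.
Qed.

Lemma is_derive_mxtrace t F DF : is_mxderive t F DF ->
  is_derive t 1 (fun s => \tr (F s)) (\tr DF).
Proof.
move=> dF.
rewrite (_ : (fun s => _) = \sum_i (fun s => F s i i)); last by apply/funext => s; rewrite fct_sumE.
by apply: is_derive_sum.
Qed.

Lemma is_mxderive_affine t (Q W : 'M[R]_M) : is_mxderive t (fun s => Q + s *: W) W.
Proof.
move=> i j.
rewrite (_ : (fun s => _) = cst (Q i j) + (W i j *: (id : R -> R))); last first.
  by apply/funext => s; rewrite !mxE mulrC.
have := is_deriveD (is_derive_cst (Q i j) t 1) (is_deriveZ (W i j) (is_derive_id t (1 : R))).
by rewrite add0r /GRing.scale/= mulr1.
Qed.
End matrix_derivative.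

(** * Rank-one updates *)

Lemma ler_nonpos_deriv (R : realType) (f f' : R -> R) (a b : R) : a <= b ->
  (forall x, a <= x <= b -> is_derive x (1 : R) f (f' x)) ->
  (forall x, a <= x <= b -> f' x <= 0) -> f b <= f a.
Proof.
move=> ab df f'0.
have I x : x \in `]a, b[ -> a <= x <= b by rewrite in_itv/= => /andP[/ltW -> /ltW ->].
apply: (@ler0_derive1_nincr R f a b) => // [x /I xab|x /I xab|].
- by have := df x xab; case.
- by have := df x xab => dfx; rewrite derive1E derive_val f'0.
apply: derivable_within_continuous => x xab.
by have := df x xab; case.
Qed.

Section rank1_update.
Context {R : realType} {M : nat}.
Implicit Types (Q B : 'M[R]_M) (v : 'cV[R]_M).

Lemma dot_rank1 (B C : 'M[R]_M) u v x :
  dot u (B *m (v *m v^T) *m C *m x) = dot u (B *m v) * dot v (C *m x).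
Proof.
have -> : B *m (v *m v^T) *m C *m x = dot v (C *m x) *: (B *m v).
  have E : (dot v (C *m x))%:M = v^T *m (C *m x).
    rewrite [RHS]mx11_scalar; congr _%:M; rewrite [in RHS]mxE /dot.
    by apply: eq_bigr => i _; congr (_ * _); rewrite mxE.
  by rewrite -mul_mx_scalar E !mulmxA.
by rewrite dotZr mulrC.
Qed.

Lemma dot_outer v x : dot x (v *m v^T *m x) = dot v x ^+ 2.
Proof.
have := dot_rank1 1%:M 1%:M x v x.
by rewrite mulmx1 !mul1mx => ->; rewrite dotC expr2.
Qed.

Lemma is_derive_dotmx (t : R) (F : R -> 'M[R]_M) (DF : 'M[R]_M) v :
  is_mxderive t F DF ->
  is_derive t (1 : R) (fun s => dot v (F s *m v)) (dot v (DF *m v)).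
Proof.
move=> dF.
rewrite (_ : (fun s => _) =
  \sum_i (cst (v i 0) * \sum_j ((fun s => F s i j) * cst (v j 0)))); last first.
  apply/funext => s; rewrite fct_sumE; apply: eq_bigr => i _.
  by rewrite mxE; congr (_ * _); rewrite fct_sumE.
apply: is_derive_eq.
  apply: is_derive_sum => i; apply: is_deriveM.
  by apply: is_derive_sum => j; apply: is_deriveM.
apply: eq_bigr => i _; rewrite scaler0 addr0 mxE /GRing.scale/=; congr (_ * _).
by apply: eq_bigr => j _; rewrite mulr0 add0r mulrC.
Qed.

(** With [g] the moment of order [K - 1] along the segment, the trace has derivative [eta * g], and
    [eta * g] grows at rate at most [c = eta L / r]. Integrating [eta * g 0 * e^(c t)] over the unit
    interval gives the stated increment. *)
Lemma mxtrace_rank1_update (eta L r : R) (k : nat) Q v :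
  let K := k.+1.*2 in let W := (eta / K%:R) *: (v *m v^T) in
  0 < r -> 0 < L -> dot v v <= L ->
  (forall t : R, 0 <= t <= 1 -> ge_scalar r (Q + t *: W)) ->
  \tr ((Q + W) ^+ K) <=
    \tr (Q ^+ K) + r / L * (expR (eta * L / r) - 1) * moment Q v K.-1.
Proof.
move=> K W r0 L0 vL hB.
pose B t := Q + t *: W.
have K0 : K%:R != 0 :> R by rewrite pnatr_eq0.
pose g t := moment (B t) v K.-1.
pose gd t := \sum_(i < K.-1) (eta / K%:R) * (moment (B t) v i * moment (B t) v (K.-2 - i)).
have dB t : is_mxderive t B W by exact: is_mxderive_affine.
have dg t : is_derive t (1 : R) g (gd t).
  apply: is_derive_eq; first by apply: is_derive_dotmx; apply: is_mxderive_exp.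
  rewrite mulmx_suml /dot.
  under eq_bigr do rewrite summxE mulr_sumr.
  rewrite exchange_big; apply: eq_bigr => i _ /=.
  rewrite -/(dot v (B t ^+ i *m W *m B t ^+ (k.*2 - i) *m v)).
  by rewrite /W -scalemxAr -!scalemxAl dotZr dot_rank1.
pose F t := \tr (B t ^+ K).
have dF t : is_derive t (1 : R) F (eta * g t).
  apply: is_derive_eq; first by apply: is_derive_mxtrace; apply: is_mxderive_exp.
  rewrite raddf_sum /= (eq_bigr (fun=> (eta / K%:R) * g t)) => [|i _].
    by rewrite sumr_const card_ord -/K -mulr_natr; field.
  rewrite [LHS](mxtrace_mulC (B t ^+ i *m W)) mulmxA.
  rewrite -[_ *m B t ^+ i]/(_ * _) -exprD subnK; last by have := ltn_ord i; lia.
  by rewrite /W -scalemxAr mxtraceZ mxtrace_rank1.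
pose c := eta * L / r.
have m_ge0 t i : 0 <= t <= 1 -> 0 <= moment (B t) v i.
  by move=> t01; apply: moment_ge0 r0 (hB _ t01) _ _.
(* Multiplying by [eta] produces the factor [eta^2], so one inequality serves both signs. Each of
   the [K - 1] products of moments is at most [m_0 m_(K-2) <= L m_(K-2)], and [r m_(K-2) <= m_(K-1)]
   by [moment_odd_ge], [K - 2] being even. *)
have gd_le t : 0 <= t <= 1 -> eta * gd t <= c * (eta * g t).
  move=> t01; have h := hB t t01.
  have K2 : forall i : 'I_K.-1, moment (B t) v i * moment (B t) v (K.-2 - i) <= L * moment (B t) v K.-2.
    move=> i; have := moment_mul_le r0 h v i (K.-2 - i); rewrite subnKC; last by have := ltn_ord i; rewrite /K; lia.
    move/le_trans; apply; apply: ler_wpM2r; first exact: m_ge0.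
    by rewrite /moment expr0 mul1mx.
  have m1 : r * moment (B t) v K.-2 <= g t by exact: (moment_odd_ge h).
  have s1 : \sum_(i < K.-1) moment (B t) v i * moment (B t) v (K.-2 - i) <= K%:R * (L * (g t / r)).
    apply: (@le_trans _ _ (\sum_(i < K.-1) L * moment (B t) v K.-2)); first exact: ler_sum.
    rewrite sumr_const card_ord -[leLHS]mulr_natl; apply: ler_pM => //.
      by rewrite mulr_ge0 ?m_ge0// ltW.
    - by rewrite ler_nat.
    - by rewrite ler_pM2l// ler_pdivlMr// mulrC.
  rewrite /gd -mulr_sumr !mulrA.
  have -> : c * eta * g t = eta * eta / K%:R * (K%:R * (L * (g t / r))).
    rewrite /c; field.
    by rewrite K0 gt_eqF.
  by apply: ler_wpM2l s1; rewrite divr_ge0// -expr2 sqr_ge0.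
have dE t : is_derive t (1 : R) (fun s => expR (c * s)) (c * expR (c * t)).
  have := @is_derive1_comp R expR (fun s => c * s) t _ c (is_derive_expR _).
  rewrite mulrC; apply.
  by apply: is_derive_eq; rewrite /GRing.scale/= mulr1.
have dEN t : is_derive t (1 : R) (fun s => expR (- c * s)) (- c * expR (- c * t)).
  have := @is_derive1_comp R expR (fun s => - c * s) t _ (- c) (is_derive_expR _).
  rewrite mulrC; apply.
  by apply: is_derive_eq; rewrite /GRing.scale/= mulr1.
(* Gronwall: [eta * g s * e^(- c s)] is nonincreasing. *)
have gle t : 0 <= t <= 1 -> eta * g t <= eta * g 0 * expR (c * t).
  move=> /andP[t0 t1].
  have := @ler_nonpos_deriv R (fun s => eta * g s * expR (- c * s))
    (fun s => (eta * gd s - c * (eta * g s)) * expR (- c * s)) 0 t t0.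
  rewrite mulr0 expR0 mulr1 => H.
  rewrite -(ler_pM2r (expR_gt0 (- c * t))) -[leRHS]mulrA -expRD mulNr subrr expR0 mulr1 -mulNr.
  apply: H => s /andP[s0 st].
    apply: is_derive_eq; rewrite /GRing.scale/=; ring.
  rewrite mulr_le0_ge0 ?expR_ge0// subr_le0 gd_le// s0.
  exact: le_trans st t1.
(* Since [r / L * c = eta], the subtracted function has derivative [eta * g 0 * e^(c s)]. Comparing
   it with [F] avoids a division by [eta], which may vanish. *)
have := @ler_nonpos_deriv R (fun s => F s - r / L * g 0 * expR (c * s))
    (fun s => eta * g s - eta * g 0 * expR (c * s)) 0 1 ler01.
rewrite mulr0 expR0 !mulr1 /F /B scale1r scale0r addr0.
rewrite /g /B scale0r addr0 -/c => H.
suff: \tr ((Q + W) ^+ K) - r / L * moment Q v K.-1 * expR c <= \tr (Q ^+ K) - r / L * moment Q v K.-1.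
  by lra.
apply: H => s s01; last by rewrite subr_le0; have := gle s s01; rewrite /g /B scale0r addr0.
have := dF s; rewrite /F/g/B => dFs.
apply: is_derive_eq; rewrite /GRing.scale/= /c.
by field; rewrite !gt_eqF.
Qed.
End rank1_update.

(** * Scalar bounds on the exponential *)

Section scalar_bounds.
Context {R : realType}.
Implicit Type z : R.

Let h z := expR (- z) * (1 + z + 18 / 25 * z ^+ 2).
Let dh z := expR (- z) * (z * (11 / 25 - 18 / 25 * z)).

Let is_derive_h z : is_derive z (1 : R) h (dh z).
Proof.
have dN : is_derive z (1 : R) (fun s : R => expR (- s)) (- expR (- z)).
  have := @is_derive1_comp R expR (fun s => - s) z _ (- 1) (is_derive_expR _).
  by rewrite mulrN1; apply; exact: is_deriveNid.
rewrite /h.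
apply: is_derive_eq; rewrite /dh /GRing.scale/=; by field.
Qed.

(** With [q = 18/25], the function [h] has derivative [e^(-z) z (2q - 1 - q z)]: it decreases to its
    value 1 at 0, then increases up to [(2q - 1)/q = 11/18]. This range just covers
    [(3/5)/(99/100)], the largest argument met in [chernoff_exponent]. *)
Lemma expR_le_quad z : z <= 11 / 18 -> expR z <= 1 + z + 18 / 25 * z ^+ 2.
Proof.
move=> zle.
suff : h 0 <= h z.
  by rewrite /h oppr0 expR0 expr0n mulr0 !addr0 mul1r expRN mulrC ler_pdivlMr ?expR_gt0// mul1r.
have [z0|z0] := leP 0 z.
  have := @ler_nonpos_deriv R (fun x => - h x) (fun x => - dh x) 0 z z0.
  rewrite lerN2; apply => x /andP[x0 xz]; first exact: is_deriveN.
  rewrite oppr_le0 /dh mulr_ge0 ?expR_ge0// mulr_ge0//; lra.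
apply: (@ler_nonpos_deriv R h dh z 0 (ltW z0)) => // x /andP[xz x0].
rewrite /dh mulr_ge0_le0 ?expR_ge0// mulr_le0_ge0//; lra.
Qed.

(** At [z = y/K] it yields [e^(y - y^2/K) <= (1 + y/K)^K], the price of using a power instead of the
    exponential. *)
Lemma expR_sub_sqr_le z : `|z| <= 1 / 10 -> expR (z - z ^+ 2) <= 1 + z.
Proof.
rewrite ler_norml => /andP[z1 z2].
apply: le_trans (expR_le_quad _) _.
  by have := sqr_ge0 z; lra.
have : (z - z ^+ 2) ^+ 2 <= 25 / 18 * z ^+ 2.
  rewrite (_ : z - z ^+ 2 = (1 - z) * z) ?exprMn; last by ring.
  apply: ler_wpM2r; rewrite ?sqr_ge0//; nra.
by lra.
Qed.
End scalar_bounds.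

(** * Extreme eigenvalues and the condition number *)

Section rayleigh.
Context {R : realType} {M : nat}.
Implicit Types (G : 'M[R]_M) (x y : 'cV[R]_M).

Lemma continuous_rV_sum (I : Type) (r : seq I) (f : I -> 'rV[R]_M -> R) :
  (forall i, continuous (f i)) -> continuous (fun z => \sum_(i <- r) f i z).
Proof.
move=> cf; elim: r => [|i r IH].
  by under eq_fun do rewrite big_nil; exact: cst_continuous.
under eq_fun do rewrite big_cons.
by move=> z; apply: continuousD; [exact: cf|exact: IH].
Qed.

Lemma continuous_dot_rV G : continuous (fun z : 'rV[R]_M => dot z^T (G *m z^T)).
Proof.
rewrite /dot; apply: continuous_rV_sum => i.
under eq_fun do rewrite !mxE mulr_sumr.
apply: continuous_rV_sum => j.
under eq_fun do rewrite mxE.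
have cz k : continuous (fun z : 'rV[R]_M => z 0 k) by exact: coord_continuous.
move=> z; apply: (@cvgM R _ (nbhs z) _ (fun z : 'rV[R]_M => z 0 i)); first exact: cz.
by apply: (@cvgM R _ (nbhs z) _ (fun=> G i j) (fun z : 'rV[R]_M => z 0 j)); [exact: cvg_cst|exact: cz].
Qed.

Lemma dot_scalar_sub G a x :
  dot x ((a%:M - G) *m x) = a * dot x x - dot x (G *m x).
Proof.
by rewrite mulmxBl mul_scalar_mx -scaleN1r dotDr !dotZr mulN1r.
Qed.

(** At a maximiser [c] of the form on the unit sphere, with value [a], the matrix [a%:M - G] is
    positive semidefinite and its form vanishes; by [psd_CS] it then annihilates [c]. Neither
    Lagrange multipliers nor a spectral theorem enter. *)
Lemma rayleigh_max G : (0 < M)%N -> G^T = G -> exists a x,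
  [/\ x != 0, G *m x = a *: x & forall y, dot y (G *m y) <= a * dot y y].
Proof.
move=> M0 sG.
(* Written with [1%:M] so that [continuous_dot_rV] applies to the constraint as well; row vectors,
   because the extreme value theorem [EVT_max_rV] is about them. *)
pose S : set 'rV[R]_M := [set z | dot z^T (1%:M *m z^T) = 1].
have S0 : S !=set0.
  exists (delta_mx 0 (Ordinal M0)); rewrite /S/= mul1mx /dot (bigD1 (Ordinal M0))//=.
  rewrite !mxE !eqxx mulr1 big1 ?addr0// => i ne.
  by rewrite !mxE (negbTE ne) mulr0.
have cS : compact S.
  apply: bounded_closed_compact.
    exists 1; split; first exact: num_real.
    move=> c c1 z; rewrite /S /= mul1mx => Sx.
    rewrite [leLHS]/Num.norm /= mx_normrE; apply: bigmax_le; first by apply: le_trans (ltW c1).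
    move=> [i j] _ /=; rewrite ord1.
    apply: le_trans (ltW c1); rewrite -(@ler_sqr _ _ 1) ?nnegrE// expr1n real_normK ?num_real//.
    rewrite -Sx /dot (bigD1 j)//= !mxE -expr2 lerDl.
    by apply: sumr_ge0 => k _; rewrite -expr2 sqr_ge0.
  apply: (@closed_comp _ _ (fun z : 'rV[R]_M => dot z^T (1%:M *m z^T)) [set 1]).
    by move=> z _; exact: continuous_dot_rV.
  exact: closed_eq.
have cG : {within S, continuous (fun z : 'rV[R]_M => dot z^T (G *m z^T))}.
  by apply: continuous_subspaceT; exact: continuous_dot_rV.
have [c] := EVT_max_rV S0 cS cG.
rewrite inE => Sc cmax.
rewrite /S/= mul1mx in Sc.
pose a := dot c^T (G *m c^T).
have amax y : dot y (G *m y) <= a * dot y y.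
  have [->|y0] := eqVneq y 0; first by rewrite mulmx0 /dot !big1 ?mulr0// => i _; rewrite mxE mul0r.
  have yy : 0 < dot y y by rewrite lt_def dot_eq0 y0 dot_ge0.
  pose t := (Num.sqrt (dot y y))^-1.
  have t2 : t * t = (dot y y)^-1 by rewrite /t -expr2 exprVn sqr_sqrtr// ltW.
  have := cmax (t *: y)^T; rewrite inE /S/= trmxK mul1mx -scalemxAr !dotZl !dotZr !mulrA t2.
  by rewrite mulVf ?gt_eqF// => /(_ erefl); rewrite mulrC ler_pdivrMr.
have c0 : c^T != 0 by rewrite -dot_eq0 Sc oner_neq0.
exists a, c^T; split => //.
have pB : psd (a%:M - G).
  split; first by rewrite linearB/= tr_scalar_mx sG.
  by move=> x; rewrite dot_scalar_sub subr_ge0.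
have E0 : dot ((a%:M - G) *m c^T) ((a%:M - G) *m c^T) = 0.
  have := psd_CS ((a%:M - G) *m c^T) c^T pB.
  rewrite (dot_scalar_sub _ _ c^T) Sc mulr1 subrr mulr0.
  move=> h; apply/eqP; rewrite -sqrf_eq0 eq_le h sqr_ge0//.
move/eqP: E0; rewrite dot_eq0 mulmxBl mul_scalar_mx subr_eq0 => /eqP ->//.
Qed.
End rayleigh.
Section extreme_eigenvalues.
Context {R : realType} {M : nat}.
Implicit Types (G : 'M[R]_M) (x y : 'cV[R]_M).

(** [eigenvalue] is defined by row vectors; symmetry allows the columns used by [dot]. *)
Lemma eigenvalue_symP G a : G^T = G ->
  reflect (exists2 x : 'cV[R]_M, x != 0 & G *m x = a *: x) (eigenvalue G a).
Proof.
move=> sG; apply: (iffP eigenvalueP) => [[v vG v0]|[x x0 Gx]].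
  by exists v^T; rewrite ?trmx_eq0// -{1}sG -trmx_mul vG linearZ.
by exists x^T; rewrite ?trmx_eq0// -{1}sG -trmx_mul Gx linearZ.
Qed.

Lemma eigenvalue_le G a b : G^T = G -> eigenvalue G b ->
  (forall y, dot y (G *m y) <= a * dot y y) -> b <= a.
Proof.
move=> sG /(eigenvalue_symP _ sG)[y y0 Gy] /(_ y).
by rewrite Gy dotZr ler_pM2r// lt_def dot_eq0 y0 dot_ge0.
Qed.

Lemma eigenvalueN G a : eigenvalue (- G) a = eigenvalue G (- a).
Proof.
apply/eigenvalueP/eigenvalueP => -[v vG v0]; exists v => //.
  by rewrite scaleNr -vG mulmxN opprK.
by rewrite mulmxN vG scaleNr opprK.
Qed.

Hypothesis M0 : (0 < M)%N.

Lemma lambda_maxP G : G^T = G -> eigenvalue G (lambda_max G) /\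
  forall y, dot y (G *m y) <= lambda_max G * dot y y.
Proof.
move=> sG; have [a [x [x0 Gx aG]]] := rayleigh_max M0 sG.
have ea : eigenvalue G a by apply/(eigenvalue_symP _ sG); exists x.
suff -> : lambda_max G = a by split.
have ub : ubound [set b | eigenvalue G b] a.
  by move=> b eb; exact: eigenvalue_le sG eb aG.
apply/eqP; rewrite eq_le; apply/andP; split.
  by apply: ge_sup => //; exists a.
by apply: ub_le_sup => //; exists a.
Qed.

Lemma lambda_minE G : lambda_min G = - lambda_max (- G).
Proof.
rewrite /lambda_min /lambda_max /inf; congr (- sup _).
apply/seteqP; split => [_ [a /= ea <-]|a /=]; rewrite /= eigenvalueN ?opprK//.
by move=> ea; exists (- a) => //; rewrite opprK.
Qed.

Lemma lambda_minP G : G^T = G -> eigenvalue G (lambda_min G) /\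
  forall y, lambda_min G * dot y y <= dot y (G *m y).
Proof.
move=> sG; have sNG : (- G)^T = - G by rewrite linearN/= sG.
have [e h] := lambda_maxP sNG; rewrite lambda_minE -eigenvalueN; split => // y.
by have := h y; rewrite mulNmx -scaleN1r dotZr mulN1r mulNr lerNl.
Qed.

(** The strict inequality holds at an eigenvector and is an open condition, so it holds at a nearby
    rational vector. The homogeneous form avoids normalising, since a unit vector need not be close
    to a rational multiple already of length one. *)
Lemma lambda_max_gtP G a : G^T = G ->
  a < lambda_max G <-> exists q : 'cV[rat]_M,
   let x := map_mx ratr q in a * dot x x < dot x (G *m x).
Proof.
move=> sG; split=> [aG|[q /= aq]]; last first.
  have := lt_le_trans aq ((lambda_maxP sG).2 _) => h.
  by rewrite ltNge; apply/negP => /(ler_wpM2r (dot_ge0 (map_mx ratr q))); rewrite leNgt h.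
have [/(eigenvalue_symP _ sG)[x x0 Gx] _] := lambda_maxP sG.
have B z : dot z ((G - a%:M) *m z) = dot z (G *m z) - a * dot z z.
  by rewrite mulmxBl mul_scalar_mx -scaleN1r dotDr !dotZr mulN1r.
have fx : 0 < dot x ((G - a%:M) *m x).
  rewrite B Gx dotZr -mulrBl mulr_gt0// ?subr_gt0// lt_def dot_eq0 x0 dot_ge0//.
have : nbhs x^T [set z : 'rV[R]_M | 0 < dot z^T ((G - a%:M) *m z^T)].
  apply: (@continuous_dot_rV _ _ (G - a%:M) x^T [set t | 0 < t]).
  by rewrite trmxK; apply: lt_nbhsr.
move=> /nbhs_ballP[e /= e0 he].
have /choice[q hq] i : exists q : rat, ball (x i 0) e (ratr q : R).
  have [|q] := @rat_in_itvoo R (x i 0 - e) (x i 0 + e); first by rewrite ltrBlDr -addrA ltrDl addr_gt0.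
  by rewrite in_itv /= => qi; exists q; rewrite /ball/= ltr_distlC.
exists (\col_i q i) => /=.
have := he (map_mx ratr (\col_i q i))^T; rewrite /= trmxK B subr_gt0; apply.
split => // i j; rewrite !mxE (ord1 i); exact: hq.
Qed.
End extreme_eigenvalues.

(** * Measurability of the condition number *)

Section cond2_measurable.
Context d (T : measurableType d) {R : realType} {M : nat}.
Hypothesis M0 : (0 < M)%N.
Implicit Type A : T -> 'M[R]_M.

Lemma measurable_ltr_set (f g : T -> R) :
  measurable_fun setT f -> measurable_fun setT g -> measurable [set w | f w < g w].
Proof.
move=> mf mg.
rewrite (_ : [set _ | _] = setT `&` [set w | ((f w)%:E < (g w)%:E)%E]).
  by apply: measurable_lte => //; exact/measurable_EFinP.
by rewrite setTI; apply/seteqP; split=> w /=; rewrite lte_fin.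
Qed.

Lemma measurable_dot_mulmx A (x : 'cV[R]_M) :
  (forall i j, measurable_fun setT (fun w => A w i j)) ->
  measurable_fun setT (fun w => dot x (A w *m x)).
Proof.
move=> mA; rewrite /dot; apply: measurable_sum => i.
apply: measurable_funM => //; under eq_fun do rewrite mxE.
by apply: measurable_sum => j; apply: measurable_funM.
Qed.

Lemma measurable_lambda_max A : (forall w, (A w)^T = A w) ->
  (forall i j, measurable_fun setT (fun w => A w i j)) ->
  measurable_fun setT (fun w => lambda_max (A w)).
Proof.
move=> sA mA; apply: (measurability _ (RGenOInfty.measurableE R)) => //.
move=> _ [_ [a ->] <-]; rewrite setTI preimage_itvoy.
rewrite (_ : [set _ | _] = \bigcup_(q : 'cV[rat]_M)
  [set w | a * dot (map_mx ratr q) (map_mx ratr q) <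
           dot (map_mx ratr q) (A w *m map_mx ratr q)]).
  apply: countable_bigcupT_measurable => [|q]; first exact: countableP.
  apply: measurable_ltr_set => //.
  exact: measurable_dot_mulmx.
apply/seteqP; split=> [w /= /(lambda_max_gtP M0 a (sA w))[q h]|w [q _ /= h]].
  by exists q.
by apply/(lambda_max_gtP M0 a (sA w)); exists q.
Qed.

Lemma measurable_cond2_le A (c : R) :
  (forall w, (A w)^T = A w) -> (forall w x, 0 <= dot x (A w *m x)) ->
  (forall i j, measurable_fun setT (fun w => A w i j)) ->
  measurable [set w | (cond2 (A w) <= c%:E)%E].
Proof.
move=> sA pA mA.
have mmax := measurable_lambda_max sA mA.
have mmin : measurable_fun setT (fun w => lambda_min (A w)).
  under eq_fun do rewrite lambda_minE.
  apply: measurable_funN; apply: measurable_lambda_max => [w|i j].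
    by rewrite linearN/= sA.
  by under eq_fun do rewrite mxE; exact: measurable_funN.
have min0 w : 0 <= lambda_min (A w).
  have [/(eigenvalue_symP _ (sA w))[x x0 Ax] _] := lambda_minP M0 (sA w).
  by have := pA w x; rewrite Ax dotZr pmulr_lge0// lt_def dot_eq0 x0 dot_ge0.
(* The first set excludes the value [+oo]; on it the bound on the quotient can be cleared of its
   denominator. *)
rewrite (_ : [set _ | _] = [set w | 0 < lambda_min (A w)] `&`
   [set w | lambda_max (A w) <= c * lambda_min (A w)]); last first.
  apply/seteqP; split=> w /=; rewrite /cond2.
    case: ifPn => [_|h]; first by rewrite leye_eq.
    have m0 : 0 < lambda_min (A w) by rewrite lt_def h min0.
    by rewrite lee_fin ler_pdivrMr.
  by move=> [m0]; rewrite gt_eqF// lee_fin ler_pdivrMr.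
apply: measurableI; first exact: measurable_ltr_set.
by rewrite -[X in measurable X]setTI; apply: measurable_fun_le => //; exact: measurable_funM.
Qed.

Lemma cond2_le (G : 'M[R]_M) delta : G^T = G -> delta < 1 ->
  (forall a, eigenvalue G a -> 1 - delta <= a <= 1 + delta) ->
  (cond2 G <= ((1 + delta) / (1 - delta))%:E)%E.
Proof.
move=> sG d1 he.
have /andP[mn _] := he _ (lambda_minP M0 sG).1.
have /andP[_ mx] := he _ (lambda_maxP M0 sG).1.
have p : 0 < 1 - delta by rewrite subr_gt0.
have m0 : 0 < lambda_min G by exact: lt_le_trans mn.
rewrite /cond2 gt_eqF// lee_fin ler_pM ?invr_ge0 ?(ltW m0)//.
  have /andP[mm _] := he _ (lambda_maxP M0 sG).1.
  by apply: le_trans mm; exact: ltW.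
by rewrite lef_pV2.
Qed.
End cond2_measurable.

(** * Bounded random variables *)

(** All integrands on the sample space are polynomials in bounded features. Boundedness everywhere
    is stable under products, unlike integrability, and implies the latter for a probability. *)
Definition bounded_rv d (T : measurableType d) (R : realType) (f : T -> R) : Prop :=
  measurable_fun setT f /\ exists c, forall w, `|f w| <= c.

Section bounded_rv.
Context d (T : measurableType d) (R : realType).
Implicit Types f g : T -> R.

Lemma bounded_rv_cst c : @bounded_rv _ T R (fun=> c).
Proof. by split; [exact: measurable_cst|exists `|c|]. Qed.

Lemma bounded_rvD f g : bounded_rv f -> bounded_rv g -> bounded_rv (fun w => f w + g w).
Proof.
move=> [mf [c fc]] [mg [b gb]]; split; first exact: measurable_funD.
by exists (c + b) => w; apply: le_trans (ler_normD _ _) _; exact: lerD.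
Qed.

Lemma bounded_rvM f g : bounded_rv f -> bounded_rv g -> bounded_rv (fun w => f w * g w).
Proof.
move=> [mf [c fc]] [mg [b gb]]; split; first exact: measurable_funM.
by exists (c * b) => w; rewrite normrM ler_pM.
Qed.

Lemma bounded_rv_sum (I : Type) (r : seq I) (f : I -> T -> R) :
  (forall i, bounded_rv (f i)) -> bounded_rv (fun w => \sum_(i <- r) f i w).
Proof.
move=> bf; elim: r => [|i r IH].
  by under eq_fun do rewrite big_nil; exact: bounded_rv_cst.
by under eq_fun do rewrite big_cons; exact: bounded_rvD.
Qed.

Lemma bounded_rv_prod (I : Type) (r : seq I) (P : pred I) (f : I -> T -> R) :
  (forall i, bounded_rv (f i)) -> bounded_rv (fun w => \prod_(i <- r | P i) f i w).
Proof.
move=> bf; elim: r => [|i r IH].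
  by under eq_fun do rewrite big_nil; exact: bounded_rv_cst.
under eq_fun do rewrite big_cons; case: (P i) => //; exact: bounded_rvM.
Qed.

Definition bounded_rmx M (A : T -> 'M[R]_M) := forall i j, bounded_rv (fun w => A w i j).

Lemma bounded_rmx_exp M (A : T -> 'M[R]_M) k :
  bounded_rmx A -> bounded_rmx (fun w => A w ^+ k).
Proof.
move=> bA; elim: k => [|k IH] i j.
  by under eq_fun do rewrite expr0; exact: bounded_rv_cst.
under eq_fun do rewrite exprS mxE.
by apply: bounded_rv_sum => l; apply: bounded_rvM.
Qed.

Variable P : probability T R.

Lemma bounded_rv_integrable f : bounded_rv f -> P.-integrable setT (EFin \o f).
Proof.
move=> [mf [c fc]]; apply: measurable_bounded_integrable => //.
  by rewrite (le_lt_trans (probability_le1 P measurableT)) ?ltry.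
exists c; split; first exact: num_real.
by move=> x cx w _; apply: le_trans (fc w) (ltW cx).
Qed.

Lemma Rintegral_sum (I : Type) (r : seq I) (f : I -> T -> R) :
  (forall i, bounded_rv (f i)) ->
  \int[P]_w (\sum_(i <- r) f i w) = \sum_(i <- r) \int[P]_w f i w.
Proof.
move=> bf; elim: r => [|i r IH].
  under eq_Rintegral do rewrite big_nil.
  by rewrite big_nil Rintegral_cst// mul0r.
under eq_Rintegral do rewrite big_cons.
rewrite big_cons RintegralD ?IH//; apply: bounded_rv_integrable => //.
exact: bounded_rv_sum.
Qed.

(** The law of the pair agrees with the product of the two laws on rectangles, hence on all
    measurable sets; the claim is then Fubini's theorem for [z.1 * z.2]. *)
Lemma Rintegral_indepM (Y Z : {RV P >-> R}) :
  bounded_rv Y -> bounded_rv Z ->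
  (forall A B, measurable A -> measurable B ->
    P (Y @^-1` A `&` Z @^-1` B) = (P (Y @^-1` A) * P (Z @^-1` B))%E) ->
  \int[P]_w (Y w * Z w) = \int[P]_w Y w * \int[P]_w Z w.
Proof.
move=> bY bZ ind.
have mW : measurable_fun setT (fun w => (Y w, Z w)) by exact: measurable_fun_pair.
pose W : {RV P >-> (R * R)%type} := mfun_Sub (mem_set mW).
pose m1 := distribution P Y; pose m2 := distribution P Z.
have mul_m : measurable_fun setT (fun z : R * R => (z.1 * z.2)%:E).
  by apply/measurable_EFinP; apply: measurable_funM.
have mE X : measurable X -> (m1 \x m2)%E X = distribution P W X.
  by apply: product_measure_unique => A B mA mB; exact: ind.
have iYZ : P.-integrable setT ((fun z : R * R => (z.1 * z.2)%:E) \o W).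
  exact: (bounded_rv_integrable (bounded_rvM bY bZ)).
have intW : (distribution P W).-integrable setT (fun z : R * R => (z.1 * z.2)%:E).
  by apply: integrable_pushforward.
have int12 : (m1 \x m2)%E.-integrable setT (fun z : R * R => (z.1 * z.2)%:E).
  move/integrableP : intW => [_ h]; apply/integrableP; split => //.
  rewrite (eq_measure_integral (distribution P W)) => // A mA _; exact: mE.
have mid : measurable_fun setT (EFin \o @idfun R).
  by apply/measurable_EFinP; exact: measurable_id.
have i2 (V : {RV P >-> R}) : bounded_rv V -> (distribution P V).-integrable setT (EFin \o idfun).
  by move=> bV; apply: integrable_pushforward => //; exact: bounded_rv_integrable.
have e2 (V : {RV P >-> R}) : bounded_rv V ->
    (\int[distribution P V]_x x%:E)%E = (\int[P]_w V w)%:E.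
  move=> bV; rewrite (integral_distribution mid); last exact: bounded_rv_integrable.
  by rewrite /Rintegral fineK//; apply: integrable_fin_num => //; exact: bounded_rv_integrable.
apply: EFin_inj; rewrite EFinM -!e2//.
rewrite {1}/Rintegral fineK; last first.
  by apply: integrable_fin_num => //; exact: bounded_rv_integrable (bounded_rvM bY bZ).
rewrite -[LHS](integral_distribution mul_m iYZ).
rewrite (eq_measure_integral (m1 \x m2)%E); last first.
  by move=> A mA _; exact: esym (mE _ mA).
rewrite -(integral12_prod_meas1 int12) /fubini_F /=.
transitivity (\int[m1]_x (x%:E * \int[m2]_y y%:E))%E.
  by apply: eq_integral => x _; under eq_integral do rewrite EFinM; rewrite integralZl//; exact: i2.
by rewrite e2// integralZr//; exact: i2.
Qed.

End bounded_rv.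

(** * Independence from the past *)

Section past.
Context d d' (T : measurableType d) (T' : measurableType d') (R : realType)
  (P : probability T R) (n : nat) (X : 'I_n -> {RV P >-> T'}).

(* A pi-system generating the sigma-algebra of the [X i] with [i < j]. *)
Definition past (j : nat) : set (set T) :=
  [set B | exists2 A : 'I_n -> set T', (forall i, measurable (A i)) &
     B = \bigcap_(i in [set i : 'I_n | (i < j)%N]) X i @^-1` A i].

Lemma past_measurable j : past j `<=` measurable.
Proof.
move=> _ [A mA ->]; apply: fin_bigcap_measurable => // i _.
by rewrite -[X in measurable X]setTI; exact: measurable_funP.
Qed.

Lemma setI_closed_past j : setI_closed (past j).
Proof.
move=> _ _ [A mA ->] [B mB ->]; exists (fun i => A i `&` B i).
  by move=> i; exact: measurableI.
by rewrite -bigcapI; apply: eq_bigcapr => i _; rewrite preimage_setI.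
Qed.

Lemma past_sub (i : 'I_n) j A : (i < j)%N -> measurable A -> past j (X i @^-1` A).
Proof.
move=> ij mA; exists (fun k => if k == i then A else setT).
  by move=> k; case: ifP.
apply/seteqP; split=> [w XA k _|w /(_ i ij)] /=; last by rewrite eqxx.
by case: eqVneq => // ->.
Qed.

Hypothesis indX : mutually_independent X.

(** For fixed [A] both sides are finite measures in [E], so it is enough to compare them on the
    pi-system [past j]. *)
Lemma past_indep (j : 'I_n) E A : <<s past j >> E -> measurable A ->
  P (E `&` X j @^-1` A) = (P E * P (X j @^-1` A))%E.
Proof.
move=> pE mA.
have mXA (i : 'I_n) B : measurable B -> measurable (X i @^-1` B).
  by move=> mB; rewrite -[X in measurable X]setTI; exact: measurable_funP.
have mX := mXA j A mA.
have r0 : 0 <= fine (P (X j @^-1` A)) by rewrite fine_ge0.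
have := @g_sigma_algebra_measure_unique _ _ _ (past j) (@past_measurable j)
  (fun=> setT) _ _ (mrestr P mX) (mscale (NngNum r0) P) (@setI_closed_past j) _ _ E pE.
have mE B : mscale (NngNum r0) P B = (P B * P (X j @^-1` A))%E.
  by rewrite /mscale /= fineK ?fin_num_measure// muleC.
rewrite -mE; apply.
- move=> _; exists (fun=> setT) => //.
  by rewrite bigcapT// => i _; rewrite preimage_setT.
- by rewrite bigcup_const.
- move=> _ [B mB ->].
  (* Intersecting a cylinder over the indices [i < j] with the condition at [j] gives a cylinder
     over [i <= j]. Mutual independence is used for both index sets. *)
  pose C i := if i == j then A else B i.
  have mC i : measurable (C i) by rewrite /C; case: ifP.
  have setE k : [set` [set i : 'I_n | k i]%SET] = [set i : 'I_n | k i].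
    by apply/seteqP; split => i /=; rewrite inE.
  have := @indX [set i : 'I_n | (i <= j)%N]%SET C (fun i _ => mC i).
  have := @indX [set i : 'I_n | (i < j)%N]%SET B (fun i _ => mB i).
  rewrite !setE => HB.
  rewrite (bigD1 j) ?inE//= {2}/C eqxx muleC => HC.
  apply: etrans (esym (mE _)); rewrite HB.
  transitivity (P (\bigcap_(i in [set i : 'I_n | (i <= j)%N]) X i @^-1` C i)).
    congr (P _); apply/seteqP; split=> [w [Bw Aw] i /= ij|w Cw].
      by rewrite /C; case: eqVneq => [->//|ne]; apply: Bw => /=; rewrite ltn_neqAle ne.
    split=> [i /= ij|]; last by have := Cw j (leqnn _); rewrite /C eqxx.
    by have := Cw i (ltnW ij); rewrite /C -val_eqE ltn_eqF.
  rewrite HC; congr (_ * _)%E; apply: eq_big => i.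
    by rewrite !inE ltn_neqAle andbC.
  by rewrite inE /C => /andP[_ /negbTE ->].
- move=> _; apply: (@le_lt_trans _ _ 1%E); last exact: ltry.
  by apply: probability_le1; exact: measurableI.
Qed.

Lemma bounded_rv_past (i : 'I_n) j (f : T' -> R) : (i < j)%N -> bounded_rv f ->
  bounded_rv (T := g_sigma_algebraType (past j)) (fun w => f (X i w)).
Proof.
move=> ij [mf [c fc]]; split; last by exists c.
move=> _ B mB; rewrite setTI; apply: sub_sigma_algebra.
rewrite -[_ @^-1` _]/(X i @^-1` (f @^-1` B)); apply: past_sub => //.
by rewrite -[X in measurable X]setTI; exact: mf.
Qed.

Lemma Rintegral_pastM (j : 'I_n) (Y : T -> R) (f : T' -> R) :
  bounded_rv (T := g_sigma_algebraType (past j)) Y -> bounded_rv f ->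
  \int[P]_w (Y w * f (X j w)) = \int[P]_w Y w * \int[P]_w f (X j w).
Proof.
move=> [mY bY] [mf bf].
have sub E : <<s past j >> E -> d.-measurable E.
  by apply: smallest_sub; [exact: sigma_algebra_measurable|exact: past_measurable].
have mY' : measurable_fun (setT : set T) Y.
  by move=> _ B mB; apply: sub; exact: mY.
have mZ : measurable_fun setT (fun w => f (X j w)) by exact: measurableT_comp.
apply: (@Rintegral_indepM _ _ _ P (mfun_Sub (mem_set mY')) (mfun_Sub (mem_set mZ))) => //.
  by split => //=; have [c h] := bf; exists c.
move=> A B mA mB; rewrite (@past_indep j _ (f @^-1` B)) //.
  by have := mY measurableT A mA; rewrite setTI.
by rewrite -[X in measurable X]setTI; exact: mf.
Qed.

End past.

(** * Trace moments of random Gram matrices *)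

Section mgf.
Context d d' (T : measurableType d) (T' : measurableType d') (R : realType)
  (P : probability T R) (n M : nat) (X : 'I_n -> {RV P >-> T'})
  (phi : 'I_M -> T' -> R) (L : R).
Hypothesis indX : mutually_independent X.
Hypothesis bphi : forall i, bounded_rv (phi i).
Hypothesis L0 : 0 < L.
Hypothesis phiL : forall p w, \sum_i phi i (X p w) ^+ 2 <= L.
Hypothesis phiE : forall p i j, \int[P]_w (phi i (X p w) * phi j (X p w)) = (i == j)%:R.

Definition feature p w : 'cV[R]_M := \col_i phi i (X p w).
(** The bound [j] is a natural number, so all partial sums up to [j = n] have one type; the strict
    inequality makes stage [j] depend only on the samples before the [j]-th. *)
Definition gram_sum j w : 'M[R]_M := \sum_(p < n | (p < j)%N) feature p w *m (feature p w)^T.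

Lemma dot_gram_sum j w x : dot x (gram_sum j w *m x) =
  \sum_(p < n | (p < j)%N) dot (feature p w) x ^+ 2.
Proof.
rewrite /gram_sum mulmx_suml; elim/big_rec2: _ => [|p y A _ <-].
  by rewrite /dot big1// => i _; rewrite mxE mulr0.
rewrite dotDr; congr (_ + _).
exact: dot_outer.
Qed.

Lemma dot_feature p w x : dot (feature p w) x ^+ 2 <= L * dot x x.
Proof.
apply: le_trans (dot_CS _ _) _; apply: ler_wpM2r; first exact: dot_ge0.
apply: le_trans (phiL p w); apply: ler_sum => i _.
by rewrite !mxE expr2.
Qed.

Lemma gram_sum_tr j w : (gram_sum j w)^T = gram_sum j w.
Proof.
by rewrite /gram_sum linear_sum /=; apply: eq_bigr => p _; rewrite trmx_mul trmxK.
Qed.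

Context (eta : R) (k : nat).
Let K := k.+1.*2.
(** Each of at most [n] rank-one terms moves the form on unit vectors by at most [|eta| L / K].
    Hence [r] is a lower bound for every matrix met on the way, for all outcomes and stages. *)
Let r := 1 - `|eta| * n%:R * L / K%:R.
Hypothesis r0 : 0 < r.
Let b := r / L * (expR (eta * L / r) - 1).
Definition pert j w : 'M[R]_M := 1%:M + (eta / K%:R) *: gram_sum j w.

Let K0 : 0 < K%:R :> R. Proof. by rewrite ltr0n. Qed.

Lemma gram_sumS (j : 'I_n) w :
  gram_sum j.+1 w = gram_sum j w + feature j w *m (feature j w)^T.
Proof.
rewrite /gram_sum (bigD1 j)//= addrC; congr (_ + _); apply: eq_bigl => i.
by rewrite ltnS ltn_neqAle andbC.
Qed.

Lemma ge_scalar_pert (j : 'I_n) w (t : R) : 0 <= t <= 1 ->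
  ge_scalar r (pert j w + t *: ((eta / K%:R) *: (feature j w *m (feature j w)^T))).
Proof.
move=> /andP[t0 t1]; split.
  rewrite /pert !linearD !linearZ/= gram_sum_tr trmx1 trmx_mul trmxK.
  by rewrite !scalerA [t * _]mulrC.
move=> x; rewrite /pert !mulmxDl mul1mx -!scalemxAl !dotDr !dotZr dot_gram_sum.
rewrite dot_outer.
set s := \sum_(p < n | _) _; set u := dot (feature j w) x ^+ 2; set q := dot x x.
have q0 : 0 <= q by exact: dot_ge0.
have u0 : 0 <= u by exact: sqr_ge0.
have s0 : 0 <= s by apply: sumr_ge0 => p _; exact: sqr_ge0.
have su : s + u <= n%:R * (L * q).
  rewrite (_ : s + u = \sum_(p < n | (p < j.+1)%N) dot (feature p w) x ^+ 2).
    apply: (@le_trans _ _ (\sum_(p < n) L * q)).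
      rewrite big_mkcond; apply: ler_sum => p _; case: ifP => _; first exact: dot_feature.
      by rewrite mulr_ge0// ltW.
    by rewrite sumr_const card_ord mulr_natl.
  rewrite [in RHS](bigD1 j)//= addrC; congr (_ + _); apply: eq_bigl => i.
  by rewrite ltnS [(i < j)%N]ltn_neqAle andbC.
have stu : s + t * u <= n%:R * (L * q).
  by apply: le_trans su; rewrite lerD2l ler_piMl.
have stu0 : 0 <= s + t * u by rewrite addr_ge0// mulr_ge0.
rewrite (_ : _ + _ = q + eta / K%:R * (s + t * u)); last by ring.
have h : - (`|eta| / K%:R * (n%:R * (L * q))) <= eta / K%:R * (s + t * u).
  rewrite lerNl; apply: le_trans (ler_norm _) _.
  rewrite normrN !normrM (ger0_norm stu0) normfV (gtr0_norm K0).
  by apply: ler_wpM2l => //; rewrite divr_ge0// ltW.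
rewrite /r mulrBl mul1r lerD2l; apply: le_trans h.
rewrite le_eqVlt; apply/orP; left; apply/eqP; field.
by rewrite gt_eqF.
Qed.

Lemma ge_scalar_pert0 (j : 'I_n) w : ge_scalar r (pert j w).
Proof. by have := @ge_scalar_pert j w 0; rewrite scale0r addr0 lexx ler01; apply. Qed.

Lemma rate_mul_eta_ge0 : 0 <= b * eta.
Proof.
rewrite /b -mulrA; apply: mulr_ge0; first by rewrite divr_ge0// ltW.
have c0 : 0 < L / r by rewrite divr_gt0.
have [e0|e0] := leP 0 eta.
  rewrite mulr_ge0// subr_ge0 -expR0 ler_expR.
  by rewrite -mulrA mulr_ge0// ltW.
rewrite mulr_le0// ?(ltW e0)// subr_le0 expR_le1 -mulrA.
by rewrite mulr_le0_ge0// ltW.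
Qed.

(** The difference of the two traces is [eta / K] times a sum of nonnegative moments, and [b] has
    the sign of [eta] by [rate_mul_eta_ge0]. This lets the one-step estimate return to the exponent
    [K] in both tails. *)
Lemma mxtrace_pert_pred (j : 'I_n) w :
  b * \tr (pert j w ^+ K.-1) <= b * \tr (pert j w ^+ K).
Proof.
rewrite -subr_ge0 -mulrBr.
have -> : \tr (pert j w ^+ K) - \tr (pert j w ^+ K.-1) =
   eta / K%:R * \sum_(p < n | (p < j)%N) moment (pert j w) (feature p w) K.-1.
  rewrite -[K]prednK// exprSr /= -[X in \tr (_ * X)]/(1%:M + _ *: _) mulrDr mulr1.
  rewrite raddfD addrC addKr /=.
  rewrite -[_ * _]/(_ *m _) -scalemxAr mxtraceZ; congr (_ * _).
  rewrite /gram_sum mulmx_sumr raddf_sum; apply: eq_bigr => p _ /=.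
  exact: mxtrace_rank1.
rewrite mulrA mulr_ge0//; first by rewrite mulrA divr_ge0 ?rate_mul_eta_ge0// ltW.
by apply: sumr_ge0 => p _; apply: moment_ge0 r0 (ge_scalar_pert0 _ _) _ _.
Qed.

Lemma bounded_past_pert j : bounded_rmx (T := g_sigma_algebraType (past X j)) (pert j).
Proof.
move=> a c; under eq_fun do rewrite !mxE summxE.
apply: bounded_rvD; first exact: bounded_rv_cst.
apply: bounded_rvM; first exact: bounded_rv_cst.
under eq_fun do rewrite big_mkcond; apply: bounded_rv_sum => p.
case pj: (p < j)%N => /=; last exact: bounded_rv_cst.
under eq_fun do rewrite mxE big_ord1 !mxE.
by apply: bounded_rvM; apply: bounded_rv_past.
Qed.

Lemma bounded_pert j : bounded_rmx (pert j).
Proof.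
move=> a c; under eq_fun do rewrite !mxE summxE.
apply: bounded_rvD; first exact: bounded_rv_cst.
apply: bounded_rvM; first exact: bounded_rv_cst.
under eq_fun do rewrite big_mkcond; apply: bounded_rv_sum => p.
case pj: (p < j)%N => /=; last exact: bounded_rv_cst.
under eq_fun do rewrite mxE big_ord1 !mxE.
have h i : bounded_rv (fun w => phi i (X p w)).
  have [mi [e ei]] := bphi i; split; last by exists e.
  exact: measurableT_comp.
exact: bounded_rvM.
Qed.

Lemma bounded_rv_mxtrace S (dS : measure_display) (T0 : measurableType dS) (A : T0 -> 'M[R]_S) :
  bounded_rmx A -> bounded_rv (fun w => \tr (A w)).
Proof. by move=> bA; apply: bounded_rv_sum. Qed.

Lemma pertS (j : 'I_n) w :
  pert j.+1 w = pert j w + (eta / K%:R) *: (feature j w *m (feature j w)^T).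
Proof. by rewrite /pert gram_sumS scalerDr addrA. Qed.

Lemma Rintegral_moment_past (j : 'I_n) i :
  \int[P]_w moment (pert j w) (feature j w) i = \int[P]_w \tr (pert j w ^+ i).
Proof.
have bi : bounded_rmx (fun w => pert j w ^+ i) by exact/bounded_rmx_exp/bounded_pert.
have bp a : bounded_rv (fun w => phi a (X j w)).
  have [ma [e ea]] := bphi a; split; last by exists e.
  exact: measurableT_comp.
transitivity (\int[P]_w \sum_a \sum_c ((pert j w ^+ i) a c * (phi a (X j w) * phi c (X j w)))).
  apply: eq_Rintegral => w _; rewrite /moment /dot; apply: eq_bigr => a _.
  by rewrite [(_ *m _) _ _]mxE mulr_sumr; apply: eq_bigr => c _; rewrite !mxE; ring.
have bt a c : bounded_rv (fun w => (pert j w ^+ i) a c * (phi a (X j w) * phi c (X j w))).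
  by apply: bounded_rvM => //; exact: bounded_rvM.
rewrite Rintegral_sum => [|a]; last exact: bounded_rv_sum.
rewrite Rintegral_sum => [|a]; last exact: bi.
apply: eq_bigr => a _; rewrite Rintegral_sum => [|c]; last exact: bt.
(* Independence factors each term, and [phiE] leaves only the diagonal [c = a]. *)
rewrite (bigD1 a)//= big1 ?addr0 => [|c ca];
  rewrite (@Rintegral_pastM _ _ _ _ _ _ _ _ indX j (fun w => (pert j w ^+ i) a _) (fun x => phi a x * phi _ x)) ?phiE ?eqxx ?mulr1//.
- by apply: bounded_rmx_exp; exact: bounded_past_pert.
- exact: bounded_rvM.
- by rewrite eq_sym (negbTE ca) mulr0.
- by apply: bounded_rmx_exp; exact: bounded_past_pert.
- exact: bounded_rvM.
Qed.

Lemma mxtrace_pert_ge0 j w : 0 <= \tr (pert j w ^+ K).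
Proof.
rewrite /K -addnn exprD -expr2; apply: mxtrace_sqr_ge0.
by rewrite trmx_exp /pert linearD linearZ/= gram_sum_tr trmx1.
Qed.

Lemma mgf_step (j : 'I_n) : \int[P]_w \tr (pert j.+1 w ^+ K) <=
  expR b * \int[P]_w \tr (pert j w ^+ K).
Proof.
have bK i l : P.-integrable setT (EFin \o (fun w => \tr (pert i w ^+ l))).
  by apply: bounded_rv_integrable; apply/bounded_rv_mxtrace/bounded_rmx_exp/bounded_pert.
have bm : P.-integrable setT (EFin \o (fun w => moment (pert j w) (feature j w) K.-1)).
  apply: bounded_rv_integrable; apply: bounded_rv_sum => a.
  have bp c : bounded_rv (fun w => feature j w c 0).
    under eq_fun do rewrite mxE.
    have [mc [e ec]] := bphi c; split; last by exists e.
    exact: measurableT_comp.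
  apply: bounded_rvM => //; under eq_fun do rewrite mxE; apply: bounded_rv_sum => c.
  by apply: bounded_rvM => //; exact/bounded_rmx_exp/bounded_pert.
have bmZ : P.-integrable setT (EFin \o (fun w => b * moment (pert j w) (feature j w) K.-1)).
  by apply: eq_integrable (integrableZl _ b bm) => //.
apply: (@le_trans _ _ (\int[P]_w (\tr (pert j w ^+ K) + b * moment (pert j w) (feature j w) K.-1))).
  apply: le_Rintegral => //; first by apply: eq_integrable (integrableD _ (bK j K) bmZ).
  move=> w _; rewrite pertS; apply: mxtrace_rank1_update => //.
  - by apply: le_trans (phiL j w); apply: ler_sum => i _; rewrite !mxE expr2.
  - by move=> t t01; exact: ge_scalar_pert.
rewrite RintegralD// RintegralZl// Rintegral_moment_past -RintegralZl//.
apply: (@le_trans _ _ ((1 + b) * \int[P]_w \tr (pert j w ^+ K))).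
  rewrite mulrDl mul1r lerD2l -RintegralZl//; apply: le_Rintegral => //.
  - by apply: eq_integrable (integrableZl _ b (bK j K.-1)).
  - by apply: eq_integrable (integrableZl _ b (bK j K)).
  - by move=> w _; exact: mxtrace_pert_pred.
(* [1 + b <= e^b] for either sign of [b]; the multiplication needs the trace of the even power to be
   nonnegative. *)
by rewrite ler_wpM2r ?expR_ge1Dx// Rintegral_ge0// => w _; exact: mxtrace_pert_ge0.
Qed.

Lemma mgf_le j : (j <= n)%N -> \int[P]_w \tr (pert j w ^+ K) <= M%:R * expR (j%:R * b).
Proof.
elim: j => [_|j IH jn].
  rewrite mul0r expR0 mulr1 (@eq_Rintegral _ _ _ _ _ (fun=> M%:R)) => [|w _].
    by rewrite Rintegral_cst// [X in fine X](_ : _ = 1%E) ?mulr1//; exact: probability_setT.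
  by rewrite /pert /gram_sum big_pred0// scaler0 addr0 expr1n mxtrace1.
apply: le_trans (mgf_step (Ordinal jn)) _.
rewrite -addn1 natrD mulrDl mul1r expRD mulrA [leRHS]mulrC.
by rewrite ler_pM2l ?expR_gt0// IH// ltnW.
Qed.

Lemma mgf_markov (tau : R) : 0 < tau ->
  (P [set w | (tau <= \tr (pert n w ^+ K))%R] <= (M%:R * expR (n%:R * b) / tau)%:E)%E.
Proof.
move=> tau0.
have bt : bounded_rv (fun w => \tr (pert n w ^+ K)).
  by apply/bounded_rv_mxtrace/bounded_rmx_exp/bounded_pert.
have := @markov _ _ _ P (mfun_Sub (mem_set bt.1)) id tau tau0 _ _ _.
rewrite expectation.unlock /= => H.
rewrite EFinM lee_pdivlMr// muleC.
have setE : [set w | (tau <= \tr (pert n w ^+ K))%R] =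
    [set w | (tau%:E <= `|\tr (pert n w ^+ K)|%:E)%E].
  by apply/seteqP; split => w /=; rewrite lee_fin ger0_norm// mxtrace_pert_ge0.
rewrite setE; apply: le_trans (H _ _ _) _ => //.
apply: le_trans (_ : (\int[P]_w \tr (pert n w ^+ K))%:E <= _)%E; last by rewrite lee_fin mgf_le.
rewrite le_eqVlt; apply/orP; left; apply/eqP.
rewrite /Rintegral fineK; last by apply: integrable_fin_num => //; exact: bounded_rv_integrable.
by apply: eq_integral => w _; rewrite /= ger0_norm// mxtrace_pert_ge0.
Qed.

End mgf.

(** * The Chernoff bound *)

Section chernoff.
Context {R : realType}.

(** [s = 1] is the upper tail and [s = -1] the lower one. [y] is the value of [eta * n * a] at the
    threshold eigenvalue [a = 1 + s delta]; the left side of the last bound is the logarithm of the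
    trace bound, up to the factor [M], over [e^(y - y^2/K)]. The part [60 n] of the bound on [K]
    gives [r >= 99/100], and [360 n / L] limits [y^2/K] to [1/250] of [delta^2 n / L]. *)
Lemma chernoff_exponent (s delta L n : R) (K : R) :
  s ^+ 2 = 1 -> 0 < delta -> delta < 1 -> 0 < L -> 0 < n -> 0 < K ->
  60 * n + 360 * n / L <= K ->
  let eta := s * (3 / 5) * delta / L in
  let y := eta * n * (1 + s * delta) in
  let r := 1 - `|eta| * n * L / K in
  [/\ 0 < r, `|y / K| <= 1 / 10 &
   n * (r / L * (expR (eta * L / r) - 1)) - y + y ^+ 2 / K
     <= - (delta ^+ 2 * (n / (3 * L)))].
Proof.
move=> s2 d0 d1 L0 n0 K0 hK eta y r.
have s1 : `|s| = 1 by apply/eqP; rewrite -(eqrXn2 (n := 2))// ?expr1n ?real_normK ?s2// num_real.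
have nL : 0 < n / L by rewrite divr_gt0.
have Kn : 60 * n <= K by lra.
have KL : 360 * n / L <= K by lra.
have absE : `|eta| = 3 / 5 * delta / L.
  rewrite (_ : eta = s * (3 / 5 * delta / L)); last by rewrite /eta; ring.
  by rewrite normrM s1 mul1r ger0_norm// divr_ge0 ?(ltW L0)// mulr_ge0// ltW.
have rE : r = 1 - 3 / 5 * delta * n / K.
  by rewrite /r absE; field; rewrite !gt_eqF.
have q : n / K <= 1 / 60 by rewrite ler_pdivrMr//; lra.
have q0 : 0 < n / K by rewrite divr_gt0.
have dq : delta * (n / K) <= 1 / 60 by apply: le_trans q; rewrite ler_piMl// ltW.
have r99 : 99 / 100 <= r by rewrite rE -mulrA -mulrA; lra.
have r1 : 0 < r by lra.
pose t := n / (L * K).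
have t0 : 0 < t by rewrite divr_gt0// mulr_gt0.
have t1 : t <= 1 / 360.
  by rewrite /t ler_pdivrMr ?mulr_gt0//; move: KL; rewrite ler_pdivrMr//; lra.
have yK : y / K = 3 / 5 * s * delta * (1 + s * delta) * t.
  by rewrite /y /eta /t; field; rewrite !gt_eqF.
have sd : `|s * delta| < 1 by rewrite normrM s1 mul1r gtr0_norm.
have abs_yK : `|y / K| <= 6 / 5 * delta * t.
  rewrite (_ : y / K = s * (1 + s * delta) * (3 / 5 * delta * t)); last by rewrite yK; ring.
  have p0 : 0 <= 3 / 5 * delta * t by apply: mulr_ge0; lra.
  rewrite normrM (ger0_norm p0) (_ : 6 / 5 * delta * t = 2 * (3 / 5 * delta * t)); last by ring.
  apply: ler_wpM2r => //; rewrite normrM s1 mul1r.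
  by apply: le_trans (ler_normD _ _) _; rewrite normr1; lra.
split => //.
  apply: le_trans abs_yK _; nra.
pose x := s * (3 / 5) * delta.
have etaL : eta * L / r = x / r.
  by rewrite /eta /x; field; rewrite !gt_eqF.
have xr : x / r <= 11 / 18.
  rewrite ler_pdivrMr//; have : s * delta < 1 by exact: le_lt_trans (ler_norm _) sd.
  rewrite /x; lra.
have x2 : x ^+ 2 = 9 / 25 * delta ^+ 2 by rewrite /x !exprMn s2; field.
have E1 : r * (expR (x / r) - 1) <= x + 18 / 25 * (x ^+ 2 / r).
  have -> : x + 18 / 25 * (x ^+ 2 / r) = r * (x / r + 18 / 25 * (x / r) ^+ 2).
    by field; rewrite gt_eqF.
  by apply: ler_wpM2l; [exact: ltW|have := expR_le_quad xr; lra].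
have x2r : x ^+ 2 / r <= 100 / 99 * x ^+ 2.
  by rewrite ler_pdivrMr// mulrAC -[leLHS]mul1r ler_wpM2r ?sqr_ge0//; lra.
have E2 : y ^+ 2 / K <= 1 / 250 * (delta ^+ 2 * (n / L)).
  have -> : y ^+ 2 / K = K * `|y / K| ^+ 2.
    by rewrite real_normK ?num_real//; field; rewrite gt_eqF.
  apply: (@le_trans _ _ (K * (6 / 5 * delta * t) ^+ 2)).
    by apply: ler_wpM2l; [exact: ltW|rewrite lerXn2r ?nnegrE// (le_trans _ abs_yK)].
  have -> : K * (6 / 5 * delta * t) ^+ 2 = delta ^+ 2 * (n / L) * (36 / 25 * t).
    by rewrite /t; field; rewrite !gt_eqF.
  rewrite mulrC ler_wpM2r//; first by rewrite mulr_ge0 ?sqr_ge0// divr_ge0// ltW.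
  lra.
(* 169/500 is just below [3/5 - (18/25)(100/99)(9/25)]; after the loss of 1/250 in [E2], 0.334
   remains against the required 1/3. *)
have E3 : n * (r / L * (expR (eta * L / r) - 1)) - y <=
    n / L * (- (169 / 500) * delta ^+ 2).
  have -> : n * (r / L * (expR (eta * L / r) - 1)) - y =
      n / L * (r * (expR (x / r) - 1) - x * (1 + s * delta)).
    by rewrite etaL /x /y /eta; field; rewrite gt_eqF.
  apply: ler_wpM2l; first exact: ltW.
  have -> : x * (1 + s * delta) = x + 3 / 5 * delta ^+ 2.
    by rewrite /x mulrDr mulr1; congr (_ + _); rewrite -[RHS]mulr1 -s2; ring.
  have := sqr_ge0 delta; lra.
have -> : delta ^+ 2 * (n / (3 * L)) = n / L * (1 / 3 * delta ^+ 2).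
  by field; rewrite gt_eqF.
have : 0 <= n / L * delta ^+ 2 by rewrite mulr_ge0 ?sqr_ge0// ltW.
move: E2 E3; lra.
Qed.

End chernoff.
Section chernoff_set.
Context d d' (T : measurableType d) (T' : measurableType d') (R : realType)
  (P : probability T R) (n M : nat) (X : 'I_n -> {RV P >-> T'})
  (phi : 'I_M -> T' -> R) (L : R).
Hypothesis indX : mutually_independent X.
Hypothesis bphi : forall i, bounded_rv (phi i).
Hypothesis L0 : 0 < L.
Hypothesis phiL : forall p w, \sum_i phi i (X p w) ^+ 2 <= L.
Hypothesis phiE : forall p i j, \int[P]_w (phi i (X p w) * phi j (X p w)) = (i == j)%:R.
Hypothesis n0 : (0 < n)%N.

(** The set [A] is a superlevel set of the trace that covers the event of an eigenvalue beyond the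
    threshold, so measurability of that event itself is not at stake. *)
Lemma chernoff_set (s delta : R) : s ^+ 2 = 1 -> 0 < delta -> delta < 1 ->
  exists A : set T, [/\ measurable A,
    (P A <= (M%:R * expR (- (delta ^+ 2 * (n%:R / (3 * L)))))%:E)%E &
    forall w a, eigenvalue (n%:R^-1 *: gram_sum X phi n w) a ->
      delta < s * (a - 1) -> A w].
Proof.
move=> s2 d0 d1.
have nR : 0 < n%:R :> R by rewrite ltr0n.
pose c := 60 * n%:R + 360 * n%:R / L.
have c0 : 0 <= c.
  by have := divr_gt0 nR L0; rewrite /c; lra.
pose k := Num.bound c.
pose K := k.+1.*2.
have K0 : 0 < K%:R :> R by rewrite ltr0n.
have cK : c <= K%:R.
  apply: le_trans (ltW (archi_boundP c0)) _; rewrite ler_nat /K; lia.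
pose eta := s * (3 / 5) * delta / L; pose y := eta * n%:R * (1 + s * delta).
pose r := 1 - `|eta| * n%:R * L / K%:R.
have [r0 yK expo] := chernoff_exponent s2 d0 d1 L0 nR K0 cK.
rewrite -/eta in r0 yK expo; rewrite -/y -/r in r0 yK expo.
pose tau := (1 + y / K%:R) ^+ K.
have yK1 : 9 / 10 <= 1 + y / K%:R.
  by move: yK; rewrite ler_norml => /andP[+ _]; lra.
have tau0 : 0 < tau by apply: exprn_gt0; lra.
have bt : bounded_rv (fun w => \tr (pert X phi eta k n w ^+ K)).
  by apply/bounded_rv_mxtrace/bounded_rmx_exp/bounded_pert.
exists [set w | (tau <= \tr (pert X phi eta k n w ^+ K))%R]; split.
- rewrite -[X in measurable X]setTI; apply: measurable_fun_le => //.
  exact: bt.1.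
- have H := @mgf_markov _ _ _ _ _ P n M X phi L indX bphi L0 phiL phiE eta k r0 tau tau0.
  apply: le_trans H _.
  rewrite lee_fin -mulrA; apply: ler_wpM2l => //.
  rewrite ler_pdivrMr//.
  apply: (@le_trans _ _ (expR (- (delta ^+ 2 * (n%:R / (3 * L)))) * expR (y - y ^+ 2 / K%:R))).
    by rewrite -expRD ler_expR; rewrite -/K -/r; move: expo; lra.
  apply: ler_wpM2l; first exact: expR_ge0.
  have -> : y - y ^+ 2 / K%:R = K%:R * (y / K%:R - (y / K%:R) ^+ 2).
    by field; rewrite gt_eqF.
  rewrite expRM_natl /tau; apply: lerXn2r; rewrite ?nnegrE ?expR_ge0//; first by lra.
  exact: expR_sub_sqr_le.
- move=> w a /eigenvalueP[v vG v0] da /=.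
  set S := gram_sum X phi n w in vG *.
  have Sv : S *m v^T = (n%:R * a) *: v^T.
    rewrite -[S]trmxK -trmx_mul gram_sum_tr.
    have -> : v *m S = n%:R *: (v *m (n%:R^-1 *: S)).
      by rewrite -scalemxAr scalerA mulfV ?scale1r// gt_eqF.
    by rewrite vG linearZ/= linearZ/= scalerA.
  set Q := pert _ _ _ _ _ _.
  have Qv : Q *m v^T = (1 + eta * (n%:R * a) / K%:R) *: v^T.
    rewrite /Q /pert mulmxDl mul1mx -scalemxAl -/S Sv scalerA scalerDl scale1r.
    by congr (_ + _ *: _); rewrite mulrAC.
  have QT : Q^T = Q by rewrite /Q /pert linearD linearZ/= gram_sum_tr trmx1.
  apply: le_trans (eigenvalue_le_mxtrace k.+1 QT _ Qv); last by rewrite trmx_eq0.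
  have h : 1 + y / K%:R <= 1 + eta * (n%:R * a) / K%:R.
    rewrite lerD2l; apply: ler_wpM2r; first by rewrite invr_ge0 ltW.
    rewrite -subr_ge0 /y.
    (* The sign [s] inside [eta] turns [delta < s (a - 1)] into a lower bound on [eta * a] in both
       tails, by [s^2 = 1]. *)
    rewrite (_ : _ - _ = n%:R * (3 / 5 * (delta / L)) * (s * (a - 1) - s ^+ 2 * delta)); last first.
      by rewrite /eta; field; rewrite gt_eqF.
    rewrite s2 mul1r mulr_ge0 ?subr_ge0 ?(ltW da)//.
    by rewrite mulr_ge0// mulr_ge0// divr_ge0// ltW.
  by apply: lerXn2r => //; rewrite nnegrE; lra.
Qed.
End chernoff_set.

Section matrix_chernoff.
Context d d' (T : measurableType d) (T' : measurableType d') (R : realType)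
  (P : probability T R) (n M : nat) (X : 'I_n -> {RV P >-> T'})
  (phi : 'I_M -> T' -> R) (L : R).

Lemma matrix_chernoff (delta : R) : mutually_independent X ->
  (forall i, bounded_rv (phi i)) -> 0 < L ->
  (forall p w, \sum_i phi i (X p w) ^+ 2 <= L) ->
  (forall p i j, \int[P]_w (phi i (X p w) * phi j (X p w)) = (i == j)%:R) ->
  (0 < n)%N -> (0 < M)%N -> 0 < delta -> delta < 1 ->
  ((1 - 2 * M%:R * expR (- (delta ^+ 2 * (n%:R / (3 * L)))))%:E
   <= P [set w | (cond2 ((n%:R : R)^-1 *: gram_sum X phi n w)
                  <= ((1 + delta) / (1 - delta))%:E)%E])%E.
Proof.
move=> indX bphi L0 phiL phiE n0 M0 d0 d1.
have nR : 0 < n%:R :> R by rewrite ltr0n.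
have [A [mA PA hA]] := chernoff_set indX bphi L0 phiL phiE n0 (expr1n _ 2) d0 d1.
have sgn2 : (-1 : R) ^+ 2 = 1 by rewrite sqrrN expr1n.
have [B [mB PB hB]] := chernoff_set indX bphi L0 phiL phiE n0 sgn2 d0 d1.
set b := M%:R * _ in PA PB.
set C := [set w | _].
have sG w : (n%:R^-1 *: gram_sum X phi n w)^T = n%:R^-1 *: gram_sum X phi n w.
  by rewrite linearZ/= gram_sum_tr.
have mC : measurable C.
  apply: measurable_cond2_le => // [w x|i j].
    rewrite -scalemxAl dotZr dot_gram_sum mulr_ge0 ?invr_ge0 ?(ltW nR)//.
    by apply: sumr_ge0 => p _; exact: sqr_ge0.
  under eq_fun do rewrite mxE summxE.
  apply: measurable_funM => //; under eq_fun do rewrite big_mkcond.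
  apply: measurable_sum => p; case: (_ < _)%N => //=.
  under eq_fun do rewrite mxE big_ord1 !mxE.
  by apply: measurable_funM; apply: measurableT_comp => //; exact: (bphi _).1.
have sub : ~` (A `|` B) `<=` C.
  move=> w nAB; apply: cond2_le => // a ea; apply/andP; split.
    rewrite leNgt; apply/negP => h; apply: nAB; right; apply: (hB w a ea).
    by rewrite mulN1r; lra.
  rewrite leNgt; apply/negP => h; apply: nAB; left; apply: (hA w a ea).
  by rewrite mul1r; lra.
have mAB : measurable (A `|` B) by exact: measurableU.
apply: (@le_trans _ _ (P (~` (A `|` B)))); last first.
  by apply: le_measure; rewrite ?inE//; exact: measurableC.
rewrite probability_setC// -mulrA -/b EFinB; apply: leeB => //.
apply: le_trans (measureU2 P mA mB) _.
by rewrite mulr_natl mulr2n EFinD; exact: leeD.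
Qed.
End matrix_chernoff.

(** * Integrals with endpoint singularities *)

Section ftc_open.
Context {R : realType}.
Notation mu := (@lebesgue_measure R).

(** For a negative exponent the weight blows up at the endpoints, so [f] is continuous only inside.
    Integrability still makes its primitive [G] continuous on the closed interval, and the mean
    value theorem applies to [F - G], whose derivative is zero. *)
Lemma FTC2_open (f F : R -> R) (a b : R) : a < b ->
  mu.-integrable `[a, b] (EFin \o f) ->
  {in `]a, b[, continuous f} ->
  {within `[a, b], continuous F} ->
  {in `]a, b[, forall x, is_derive x (1 : R) F (f x)} ->
  \int[mu]_(x in `[a, b]) f x = F b - F a.
Proof.
move=> ab fi cf cF dF.
pose G x := \int[mu]_(t in `[a, x]) f t.
have cG : {within `[a, b], continuous G}.
  exact: parameterized_integral_continuous (ltW ab) fi.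
have dG x : x \in `]a, b[ -> is_derive x (1 : R) G (f x).
  move=> xab; move: (xab); rewrite in_itv/= => /andP[ax xb].
  have [] := continuous_FTC1_closed xb fi ax (cf x xab).
  by move=> dGx EG; apply: (DeriveDef dGx); rewrite -derive1E.
have [x xab|x|c cab] := @MVT R (F \- G) (fun=> 0) a b ab.
- have := dF x xab; have := dG x xab => h1 h2.
  by apply: is_derive_eq; rewrite subrr.
- by apply: cvgB; [exact: cF|exact: cG].
rewrite mul0r => /eqP; rewrite subr_eq0 => /eqP /= E.
have Ga : G a = 0 by rewrite /G set_itv1 Rintegral_set1.
by move: E; rewrite Ga subr0 -/(G b); lra.
Qed.
End ftc_open.

Section jacobi_weight_integrable.
Context {R : realType}.
Notation mu := (@lebesgue_measure R).
Let f0 (x : R) := (Num.sqrt (1 - x ^+ 2))^-1.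

Let sub1sqr_gt0 (x : R) : -1 < x < 1 -> 0 < 1 - x ^+ 2.
Proof. by move=> /andP[x1 x2]; rewrite subr_gt0; nra. Qed.

Let continuous_f0 (x : R) : -1 < x < 1 -> {for x, continuous f0}.
Proof.
move=> x1; have h := sub1sqr_gt0 x1.
apply: cvgV; first by rewrite gt_eqF// sqrtr_gt0.
apply: (@continuous_comp _ _ _ (fun x : R => 1 - x ^+ 2) Num.sqrt).
  by apply: cvgB; [exact: cvg_cst|exact: exprn_continuous].
exact: sqrt_continuous.
Qed.

Let b_ (i : nat) : R := 1 - (i.+2%:R)^-1.

Let b_lt1 i : 0 < b_ i < 1.
Proof.
have h : 0 < (i.+2%:R : R)^-1 by rewrite invr_gt0 ltr0n.
have h1 : (i.+2%:R : R)^-1 < 1 by rewrite invf_lt1 ?ltr0n// ltr1n.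
by rewrite /b_ subr_gt0 h1/= ltrBlDr ltrDl.
Qed.

Let b_sub i (x : R) : - b_ i <= x <= b_ i -> -1 < x < 1.
Proof.
have /andP[b0 b1] := b_lt1 i; move=> /andP[h1 h2].
by apply/andP; split; lra.
Qed.

Let F_ (i : nat) : set R := `[- b_ i, b_ i].

Let F_cover : \bigcup_i F_ i = `]-1, 1[%classic.
Proof.
apply/seteqP; split=> [x [i _] /=|x /=]; rewrite !in_itv/=.
  exact: b_sub.
move=> /andP[x1 x2].
have d : 0 < 1 - `|x| by rewrite subr_gt0 ltr_norml x1.
exists (Num.bound (1 - `|x|)^-1) => //; rewrite /F_ /= in_itv/= -ler_norml /b_ lerBrDl -lerBrDr.
rewrite -[leRHS]invrK lef_pV2 ?posrE ?invr_gt0//.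
apply: le_trans (ltW (archi_boundP _)) _; first by rewrite invr_ge0 ltW.
by rewrite ler_nat -addn2 leq_addr.
Qed.

(** Arcsine is a primitive inside but has infinite slope at the endpoints. On each [[- b_ i, b_ i]]
    the integral is at most pi, and monotone convergence passes to the union. *)
Lemma integral_asin_le : (\int[mu]_(x in `](-1)%R, 1%R[) (f0 x)%:E <= pi%:E)%E.
Proof.
have f00 x : 0 <= f0 x by rewrite invr_ge0 sqrtr_ge0.
have mf i : measurable_fun (F_ i) (EFin \o f0).
  apply/measurable_EFinP; apply: subspace_continuous_measurable_fun; first exact: measurable_itv.
  apply: continuous_in_subspaceT => x; rewrite inE /F_ /= in_itv/= => xi.
  exact/continuous_f0/(b_sub xi).
have nd : nondecreasing_seq F_.
  move=> i j ij; apply/subsetPset => x; rewrite /F_ /= !in_itv/= -!ler_norml => /le_trans; apply.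
  by rewrite /b_ lerD2l lerN2 lef_pV2 ?posrE ?ltr0n// ler_nat.
have cvg : (\int[mu]_(x in F_ i) (f0 x)%:E)%E @[i --> \oo] -->
    (\int[mu]_(x in `](-1)%R, 1%R[) (f0 x)%:E)%E.
  rewrite -F_cover; apply: ge0_nondecreasing_set_cvg_integral => //.
  - by move=> i; exact: measurable_itv.
  - by move=> i x _; rewrite lee_fin.
move/cvg_lim : (cvg) => <-//; apply: lime_le; first by apply/cvg_ex; eexists; exact: cvg.
apply: nearW => i.
have /andP[b0 b1] := b_lt1 i.
rewrite (@continuous_FTC2 _ f0 asin); first 1 last.
- by lra.
- apply: continuous_in_subspaceT => x; rewrite inE /F_ /= in_itv/= => xi.
  exact/continuous_f0/(b_sub xi).
- split.
  + move=> x; rewrite in_itv/= => xi.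
    have xi1 : -1 < x < 1 by apply: (@b_sub i); case/andP: xi => /ltW -> /ltW ->.
    by have := is_derive1_asin xi1; case.
  + by apply: cvg_at_right_filter; apply: continuous_asin; apply/andP; split; lra.
  + by apply: cvg_at_left_filter; apply: continuous_asin; apply/andP; split; lra.
- move=> x; rewrite in_itv/= => xi; rewrite derive1E.
  have xi1 : -1 < x < 1 by apply: (@b_sub i); case/andP: xi => /ltW -> /ltW ->.
  by have := is_derive1_asin xi1; case.
rewrite -EFinB lee_fin.
have := @asin_lepi2 R (b_ i); have := @asin_geNpi2 R (- b_ i).
have -> : -1 <= - b_ i <= 1 by apply/andP; split; lra.
have -> : -1 <= b_ i <= 1 by apply/andP; split; lra.
by move=> /(_ isT) + /(_ isT); lra.
Qed.
End jacobi_weight_integrable.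

(** * Polynomials against the Jacobi weight *)

Section weighted_integral.
Context {R : realType}.
Notation mu := (@lebesgue_measure R).
Implicit Types (alpha : R) (p q : {poly R}).

Lemma jacobi_weight_ge0 alpha (x : R) : 0 <= jacobi_weight alpha x.
Proof. exact: powR_ge0. Qed.

Lemma measurable_jacobi_weight alpha D : measurable_fun D (@jacobi_weight R alpha).
Proof.
apply: measurable_funTS.
rewrite (_ : jacobi_weight alpha = (fun y => y `^ alpha) \o (fun x => 1 - x ^+ 2))//.
apply: measurableT_comp; first exact: measurable_powR.
by apply: measurable_funB => //; exact: measurable_funX.
Qed.

Lemma sub1_sqr_gt0 (x : R) : -1 < x < 1 -> 0 < 1 - x ^+ 2.
Proof. by move=> /andP[x1 x2]; rewrite subr_gt0; nra. Qed.

Lemma sub1_sqr_itv (x : R) : -1 <= x <= 1 -> 0 <= 1 - x ^+ 2 <= 1.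
Proof.
move=> /andP[x1 x2]; apply/andP; split; last by have := sqr_ge0 x; lra.
by rewrite subr_ge0; nra.
Qed.

(** As [0 < 1 - x^2 <= 1] inside, every exponent from -1/2 on is dominated by the Chebyshev weight
    [(1 - x^2)^(-1/2)]. The endpoints are removed before the comparison. *)
Lemma integrable_jacobi_weight alpha : - 2^-1 <= alpha ->
  mu.-integrable `[-1, 1] (EFin \o @jacobi_weight R alpha).
Proof.
move=> a2.
apply/integrableP; split; first by apply/measurable_EFinP; apply: measurable_jacobi_weight.
under eq_integral do rewrite /= ger0_norm ?jacobi_weight_ge0//.
rewrite -integral_itv_obnd_cbnd; last by apply/measurable_EFinP; apply: measurable_jacobi_weight.
rewrite -integral_itv_bndo_bndc; last by apply/measurable_EFinP; apply: measurable_jacobi_weight.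
apply: le_lt_trans (ltry pi); apply: le_trans (@integral_asin_le R).
apply: ge0_le_integral => //.
- by move=> x _; rewrite lee_fin jacobi_weight_ge0.
- by apply/measurable_EFinP; apply: measurable_jacobi_weight.
- apply/measurable_EFinP; apply: open_continuous_measurable_fun => // x.
  rewrite inE/= in_itv/= => /sub1_sqr_gt0 h.
  apply: cvgV; first by rewrite gt_eqF// sqrtr_gt0.
  apply: (@continuous_comp _ _ _ (fun x : R => 1 - x ^+ 2) Num.sqrt).
    by apply: cvgB; [exact: cvg_cst|exact: exprn_continuous].
  exact: sqrt_continuous.
move=> x /=; rewrite in_itv/= => x1; have h := sub1_sqr_gt0 x1.
have /andP[x1l x1r] := x1.
have /andP[_ h1] : 0 <= 1 - x ^+ 2 <= 1 by apply: sub1_sqr_itv; rewrite (ltW x1l) (ltW x1r).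
rewrite lee_fin -powR12_sqrt ?(ltW h)// -powRN.
by apply: ger_powR => //; rewrite h.
Qed.

Lemma horner_bounded p : exists c, forall x, -1 <= x <= 1 -> `|p.[x]| <= c.
Proof.
exists (\sum_(i < size p) `|p`_i|) => x x1.
rewrite horner_coef; apply: le_trans (ler_norm_sum _ _ _) _.
apply: ler_sum => i _; rewrite normrM ler_piMr// normrX exprn_ile1//.
by rewrite ler_norml.
Qed.

Lemma measurable_horner D p : measurable_fun D (fun x : R => p.[x]).
Proof.
by apply: measurable_funTS; apply: continuous_measurable_fun; exact: continuous_horner.
Qed.

Lemma integrable_horner_weight alpha p : - 2^-1 <= alpha ->
  mu.-integrable `[-1, 1] (EFin \o (fun x => p.[x] * jacobi_weight alpha x)).
Proof.
move=> a2; have [c pc] := horner_bounded p.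
have iw : mu.-integrable `[-1, 1] (fun x => c%:E * (jacobi_weight alpha x)%:E)%E.
  by apply: integrableZl => //; exact: integrable_jacobi_weight.
apply: (le_integrable _ _ _ iw) => //.
  apply/measurable_EFinP/measurable_funM; first exact: measurable_horner.
  exact: measurable_jacobi_weight.
move=> x /=; rewrite in_itv/= => x1; rewrite lee_fin !normrM ler_wpM2r//.
by apply: le_trans (pc _ x1) (ler_norm _).
Qed.

Definition wint alpha p := \int[mu]_(x in `[-1, 1]) (p.[x] * jacobi_weight alpha x).

Lemma wint1 alpha : wint alpha 1 = jacobi_h0 alpha.
Proof.
by apply: eq_Rintegral => x _; rewrite hornerC mul1r.
Qed.

Lemma wintD alpha p q : - 2^-1 <= alpha -> wint alpha (p + q) = wint alpha p + wint alpha q.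
Proof.
move=> a2; rewrite /wint -RintegralD//; try exact: integrable_horner_weight.
by apply: eq_Rintegral => x _; rewrite hornerD mulrDl.
Qed.

Lemma wintZ alpha c p : - 2^-1 <= alpha -> wint alpha (c *: p) = c * wint alpha p.
Proof.
move=> a2; rewrite /wint -RintegralZl//; last exact: integrable_horner_weight.
by apply: eq_Rintegral => x _; rewrite hornerZ mulrA.
Qed.

Lemma wintB alpha p q : - 2^-1 <= alpha -> wint alpha (p - q) = wint alpha p - wint alpha q.
Proof. by move=> a2; rewrite wintD// -scaleN1r wintZ// mulN1r. Qed.

Lemma wint_shift alpha p : - 2^-1 <= alpha ->
  wint (alpha + 1) p = wint alpha ((1 - 'X^2) * p).
Proof.
move=> a2; apply: eq_Rintegral => x; rewrite inE/= in_itv/= => x1.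
have /andP[h _] := sub1_sqr_itv x1.
rewrite hornerM hornerD hornerN hornerXn hornerC mulrAC mulrC; congr (_ * _).
rewrite /jacobi_weight powRD ?powRr1// 1?mulrC//.
by apply/implyP; rewrite gt_eqF//; lra.
Qed.

(** Times the weight, this polynomial is the derivative of [(1 - x^2)^(alpha + 1) p], which vanishes
    at both ends because [alpha + 1 > 0]. Orthogonality and the recursions for the norms and for
    [jacobi_h0] come from it by a choice of [p]. *)
Lemma wint_byparts alpha p : - 2^-1 <= alpha ->
  wint alpha ((1 - 'X^2) * p^`() - (2 * (alpha + 1)) *: ('X * p)) = 0.
Proof.
move=> a2.
pose F (x : R) := (1 - x ^+ 2) `^ (alpha + 1) * p.[x].
rewrite /wint (@FTC2_open _ _ F).
- by rewrite /F sqrrN expr1n subrr powR0 ?mul0r ?subrr// gt_eqF//; lra.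
- by lra.
- exact: integrable_horner_weight.
- move=> x; rewrite in_itv/= => x1.
  have h := sub1_sqr_gt0 x1.
  apply: cvgM; first exact: continuous_horner.
  apply: (@continuous_comp _ _ _ (fun x : R => 1 - x ^+ 2) (fun y => y `^ alpha)).
    by apply: cvgB; [exact: cvg_cst|exact: exprn_continuous].
  apply/differentiable_continuous/derivable1_diffP.
  by apply: derivable_powR; rewrite in_itv/= h.
- apply/continuous_within_itvP; first by lra.
  have cF (x : R) : -1 < x < 1 -> {for x, continuous F}.
    move=> /sub1_sqr_gt0 h; apply: cvgM; last exact: continuous_horner.
    apply: (@continuous_comp _ _ _ (fun x : R => 1 - x ^+ 2) (fun y => y `^ (alpha + 1))).
      by apply: cvgB; [exact: cvg_cst|exact: exprn_continuous].
    apply/differentiable_continuous/derivable1_diffP.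
    by apply: derivable_powR; rewrite in_itv/= h.
  have [c pc] := horner_bounded p.
  (* [alpha + 1 >= 1/2] gives [|F| <= g], and [g] squeezes [F] to 0 at the endpoints. *)
  pose g (x : R) := c * Num.sqrt (1 - x ^+ 2).
  have cg (x : R) : {for x, continuous g}.
    apply: cvgM; first exact: cvg_cst.
    apply: (@continuous_comp _ _ _ (fun x : R => 1 - x ^+ 2) Num.sqrt).
      by apply: cvgB; [exact: cvg_cst|exact: exprn_continuous].
    exact: sqrt_continuous.
  have Fg x : -1 < x < 1 -> - g x <= F x <= g x.
    move=> x1; rewrite -ler_norml /F /g normrM mulrC.
    have h := sub1_sqr_gt0 x1.
    have x1' : -1 <= x <= 1 by case/andP : x1 => /ltW -> /ltW ->.
    have /andP[_ h1] := sub1_sqr_itv x1'.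
    apply: ler_pM => //; first exact: pc.
    rewrite ger0_norm ?powR_ge0// -powR12_sqrt ?(ltW h)//.
    by apply: ger_powR; [rewrite h|lra].
  have F0 x : x ^+ 2 = 1 -> F x = 0.
    by move=> x2; rewrite /F x2 subrr powR0 ?mul0r// gt_eqF//; lra.
  have g0 x : x ^+ 2 = 1 -> g x = 0.
    by move=> x2; rewrite /g x2 subrr sqrtr0 mulr0.
  have sqN1 : (-1 : R) ^+ 2 = 1 by rewrite sqrrN expr1n.
  split.
  + by move=> x; rewrite in_itv/=; exact: cF.
  + rewrite F0//; apply: (@squeeze_cvgr _ _ _ _ (fun x => - g x) g).
    * near=> x; apply: Fg; apply/andP; split => //.
    * rewrite -oppr0 -(g0 (-1))//; apply: cvgN; apply: cvg_at_right_filter; exact: cg.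
    * rewrite -(g0 (-1))//; apply: cvg_at_right_filter; exact: cg.
  + rewrite F0 ?expr1n//; apply: (@squeeze_cvgr _ _ _ _ (fun x => - g x) g).
    * near=> x; apply: Fg; apply/andP; split => //.
    * rewrite -oppr0 -(g0 1) ?expr1n//; apply: cvgN; apply: cvg_at_left_filter; exact: cg.
    * rewrite -(g0 1) ?expr1n//; apply: cvg_at_left_filter; exact: cg.
- move=> x; rewrite in_itv/= => x1; have h := sub1_sqr_gt0 x1.
  have dw : is_derive x (1 : R) (fun x : R => (1 - x ^+ 2) `^ (alpha + 1))
      ((alpha + 1) * (1 - x ^+ 2) `^ alpha * (- (2 * x))).
    have := @is_derive1_comp R (fun y : R => y `^ (alpha + 1)) (fun x => 1 - x ^+ 2) x _ (- (2 * x)) (is_derive1_powR _ h).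
    rewrite addrK => H; apply: H.
    apply: is_derive_eq; rewrite /GRing.scale/=; ring.
  have dp : is_derive x (1 : R) (fun x : R => p.[x]) (p^`()).[x].
    apply: DeriveDef; first exact: derivable_horner.
    by rewrite -derive1E derivE.
  apply: is_derive_eq.
  have -> : (1 - x ^+ 2) `^ (alpha + 1) = (1 - x ^+ 2) * (1 - x ^+ 2) `^ alpha.
    by rewrite powRD ?powRr1 ?(ltW h)// 1?mulrC//; rewrite (gt_eqF h) implybT.
  rewrite /GRing.scale/= /jacobi_weight hornerD hornerN hornerZ !hornerM hornerD hornerN hornerXn hornerX hornerC; ring.
Unshelve. all: by end_near. Qed.
End weighted_integral.

(** * Jacobi polynomials *)

Section jacobi_algebra.
Context {R : realType}.
Implicit Types (a : R) (k v : nat).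

Definition jacobi_coef a k v : R := (k`!%:R)^-1 * ('C(k, v)%:R
  * (\prod_(1 <= i < v.+1) (k%:R + a + a + i%:R))
  * (\prod_(v.+1 <= i < k.+1) (a + i%:R))).

Let U : {poly R} := 'X - 1.

Lemma jacobiE a k : jacobi a a k = \sum_(v < k.+1) (jacobi_coef a k v / 2 ^+ v) *: U ^+ v.
Proof.
rewrite /jacobi scaler_sumr; apply: eq_bigr => v _.
by rewrite scalerA exprZn scalerA exprVn.
Qed.

Lemma derivU v : (U ^+ v)^`() = v%:R *: U ^+ v.-1.
Proof. by rewrite deriv_exp derivB derivX derivC subr0 mul1r scaler_nat. Qed.

(** The ratio of consecutive coefficients, cleared of denominators. Both sides vanish at [v = k], so
    the relation covers the whole sum in [jacobi_ode]. *)
Lemma jacobi_coefS a k v : (v <= k)%N ->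
  jacobi_coef a k v.+1 * v.+1%:R * (v.+1%:R + a) =
  jacobi_coef a k v * (k%:R - v%:R) * (k%:R + v%:R + 2 * a + 1).
Proof.
rewrite /jacobi_coef leq_eqVlt => /predU1P[->|vk].
  by rewrite bin_small// !mul0r mulr0 !mul0r subrr mulr0 mul0r.
rewrite [\prod_(v.+1 <= i < _) _]big_ltn//.
rewrite [\prod_(1 <= i < v.+2) _]big_nat_recr//=.
have := congr1 (fun n => n%:R : R) (mul_bin_left k v).
rewrite !natrM natrB 1?ltnW// => E.
rewrite -!(natr1 v) in E *.
set b := 'C(k, v.+1)%:R in E *; set c := 'C(k, v)%:R in E *.
set p := \prod_(1 <= i < v.+1) _; set q := \prod_(v.+2 <= i < _) _.
transitivity ((k`!%:R)^-1 * (b * (v%:R + 1)) * p * q * (k%:R + a + a + (v%:R + 1)) * (a + (v%:R + 1))); first by ring.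
by rewrite mulrC in E; rewrite E; ring.
Qed.

Definition jacobi_eigen a k : R := k%:R * (k%:R + 2 * a + 1).

Let ode_term a k v :
  (1 - 'X^2) * (U ^+ v)^`()^`() - (2 * (a + 1)) *: ('X * (U ^+ v)^`())
    + jacobi_eigen a k *: U ^+ v =
  ((k%:R - v%:R) * (k%:R + v%:R + 2 * a + 1)) *: U ^+ v -
  (2 * v%:R * (v%:R + a)) *: U ^+ v.-1.
Proof.
have -> : 'X = U + 1 by rewrite subrK.
rewrite !(derivU, derivZ) /jacobi_eigen.
case: v => [|[|v]] /=.
- rewrite !scale0r !(mulr0, scaler0, mul0r, scale0r, subr0, add0r, addr0). by rewrite oppr0 add0r.
- by rewrite expr0 expr1 -!mul_polyC; ring.
by rewrite !exprS -!mul_polyC; ring.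
Qed.

(** The operator maps [(x - 1)^v] to a combination of the powers [v] and [v - 1] ([ode_term]). By
    [jacobi_coefS] the sum telescopes, and both boundary terms are zero. *)
Lemma jacobi_ode a k :
  (1 - 'X^2) * (jacobi a a k)^`()^`() - (2 * (a + 1)) *: ('X * (jacobi a a k)^`())
    + jacobi_eigen a k *: jacobi a a k = 0.
Proof.
pose f v : {poly R} := (jacobi_coef a k v / 2 ^+ v * (2 * v%:R * (v%:R + a))) *: U ^+ v.-1.
transitivity (\sum_(v < k.+1) (f v.+1 - f v)).
  have E1 : (jacobi a a k)^`() = \sum_(v < k.+1) (jacobi_coef a k v / 2 ^+ v) *: (U ^+ v)^`().
    by rewrite jacobiE raddf_sum /=; apply: eq_bigr => v _; rewrite derivZ.
  rewrite E1 raddf_sum /= jacobiE !mulr_sumr !scaler_sumr -sumrN -!big_split /=.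
  apply: eq_bigr => v _.
  transitivity ((jacobi_coef a k v / 2 ^+ v) *:
    ((1 - 'X^2) * (U ^+ v)^`()^`() - (2 * (a + 1)) *: ('X * (U ^+ v)^`())
    + jacobi_eigen a k *: U ^+ v)).
    by rewrite derivZ !scalerDr scalerN -!scalerAr !scalerA ![_ * (jacobi_coef a k v / _)]mulrC.
  rewrite ode_term scalerDr scalerN !scalerA /f /=; congr (_ *: _ - _).
  have := jacobi_coefS a (ltnSE (ltn_ord v)); rewrite exprS => H.
  have t0 : (2 : R) != 0 by rewrite pnatr_eq0.
  have T0 : (2 : R) ^+ v != 0 by rewrite expf_neq0.
  transitivity (jacobi_coef a k v * (k%:R - v%:R) * (k%:R + v%:R + 2 * a + 1) / 2 ^+ v); first by field.
  by rewrite -H; field; rewrite ?T0 ?t0.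
rewrite -(big_mkord xpredT (fun v => f v.+1 - f v)) telescope_sumr//.
rewrite /f mulr0 mul0r mulr0 scale0r subr0.
by rewrite /jacobi_coef bin_small// !mul0r mulr0 !mul0r scale0r.
Qed.

Lemma jacobi_coef_deriv a k v :
  jacobi_coef a k.+1 v.+1 * v.+1%:R = (k%:R + 2 * a + 2) * jacobi_coef (a + 1) k v.
Proof.
rewrite /jacobi_coef.
rewrite [\prod_(1 <= i < v.+2) _]big_ltn// [\prod_(2 <= i < _) _]big_add1 /=.
rewrite [\prod_(v.+2 <= i < _) _]big_add1 /=.
have -> : \prod_(1 <= i < v.+1) (k.+1%:R + a + a + i.+1%:R) =
    \prod_(1 <= i < v.+1) (k%:R + (a + 1) + (a + 1) + i%:R).
  by apply: eq_bigr => i _; rewrite -!natr1; ring.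
have -> : \prod_(v.+1 <= i < k.+1) (a + i.+1%:R) =
    \prod_(v.+1 <= i < k.+1) (a + 1 + i%:R).
  by apply: eq_bigr => i _; rewrite -!natr1; ring.
set p := \prod_(1 <= i < _) _; set q := \prod_(v.+1 <= i < _) _.
have f0 : (k`!%:R : R) != 0 by rewrite pnatr_eq0 -lt0n fact_gt0.
have k0 : (k.+1%:R : R) != 0 by rewrite pnatr_eq0.
have k1 : (1 + k%:R : R) != 0 by rewrite nat1r.
rewrite factS natrM.
transitivity ((k`!%:R)^-1 * (k.+1%:R)^-1 * (v.+1%:R * 'C(k.+1, v.+1)%:R) * (k.+1%:R + a + a + 1) * p * q).
  by field; rewrite f0 k1.
have -> : v.+1%:R * 'C(k.+1, v.+1)%:R = k.+1%:R * 'C(k, v)%:R :> R.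
  by rewrite -!natrM -mul_bin_diag.
by field; rewrite f0 k1.
Qed.

Lemma jacobi_deriv a k : (jacobi a a k.+1)^`() =
  ((k%:R + 2 * a + 2) / 2) *: jacobi (a + 1) (a + 1) k.
Proof.
rewrite !jacobiE raddf_sum /= big_ord_recl expr0 derivZ derivC scaler0 add0r.
rewrite scaler_sumr; apply: eq_bigr => v _.
rewrite derivZ derivU !scalerA /= exprS; congr (_ *: _).
rewrite /bump /= add1n.
have T0 : (2 : R) ^+ v != 0 by rewrite expf_neq0// pnatr_eq0.
transitivity (jacobi_coef a k.+1 v.+1 * v.+1%:R / (2 * 2 ^+ v)); first by rewrite mulrAC.
by rewrite jacobi_coef_deriv; field.
Qed.

Lemma jacobi_at1 a k : (jacobi a a k).[1] = (\prod_(1 <= i < k.+1) (a + i%:R)) / k`!%:R.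
Proof.
rewrite jacobiE horner_sum big_ord_recl big1 => [|v _].
  by rewrite addr0 /= !expr0 alg_polyC hornerC /jacobi_coef bin0 big_geq// !mul1r divr1 mulrC.
by rewrite hornerZ horner_exp !hornerE subrr expr0n mulr0.
Qed.

Lemma size_jacobi a k : (size (jacobi a a k) <= k.+1)%N.
Proof.
rewrite jacobiE; apply: leq_trans (size_sum _ _ _) _; apply/bigmax_leqP => v _.
apply: leq_trans (size_scale_leq _ _) _.
by rewrite /U -polyC1 size_exp_XsubC.
Qed.

Lemma jacobi_eigen_lt a j k : - 2^-1 <= a -> (j < k)%N -> jacobi_eigen a j < jacobi_eigen a k.
Proof.
move=> a2 jk; rewrite -subr_gt0.
have -> : jacobi_eigen a k - jacobi_eigen a j = (k%:R - j%:R) * (k%:R + j%:R + 2 * a + 1).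
  by rewrite /jacobi_eigen; ring.
have h : (j%:R : R) < k%:R by rewrite ltr_nat.
have h0 : (0 : R) <= j%:R by [].
by apply: mulr_gt0; lra.
Qed.
End jacobi_algebra.

(** * Parity, and the maximum at the endpoints *)

Section jacobi_parity.
Context {R : realType}.
Implicit Types (a : R) (k j : nat).

(** In powers of [x] the differential equation links coefficients two apart, which exposes the
    parity hidden by the expansion at 1. *)
Lemma jacobi_coef_rec a k j :
  (jacobi_eigen a j - jacobi_eigen a k) * (jacobi a a k)`_j =
  (j.+2 * j.+1)%:R * (jacobi a a k)`_j.+2.
Proof.
set y := jacobi a a k.
have E1 : (if (j < 2)%N then 0 else y`_(j - 2).+2 *+ (j - 2).+2 *+ (j - 2).+1)
    = (j%:R * (j%:R - 1)) * y`_j.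
  case: ltnP => j2; first by case: j j2 => [|[|]]// _; rewrite ?mul0r ?subrr ?mulr0 ?mul0r.
  have -> : (j - 2).+2 = j by lia.
  have -> : (j - 2).+1 = j.-1 by lia.
  by rewrite -mulrnA -[LHS]mulr_natl natrM -subn1 natrB 1?ltnW.
have E2 : (if j == 0%N then 0 else y`_j.-1.+1 *+ j.-1.+1) = j%:R * y`_j.
  by case: (j) => [|i] /=; rewrite ?mul0r// mulr_natl.
move: E1 E2 (jacobi_ode a k); rewrite -/y; move: y => y E1 E2 /(congr1 (fun p : {poly R} => p`_j)).
rewrite mulrBl mul1r !(coefD, coefN, coefB, coefZ, coefXM, coefXnM, coef_deriv, coef0) /= E1 E2.
rewrite -mulrnA -[_ *+ (_ * _)]mulr_natl /jacobi_eigen => H.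
apply/eqP; rewrite -subr_eq0 -oppr_eq0; apply/eqP; rewrite -[RHS]H; ring.
Qed.

(** Downward induction with fuel [i]: above [k] the coefficients are zero, and below [k] the
    recurrence has the nonzero factor [jacobi_eigen a j - jacobi_eigen a k]. *)
Lemma jacobi_coef_odd a k j : - 2^-1 <= a -> odd (j + k) -> (jacobi a a k)`_j = 0.
Proof.
move=> a2.
suff H i : forall j, (k < j + i)%N -> odd (j + k) -> (jacobi a a k)`_j = 0.
  by apply: (H k.+1); rewrite addnS ltnS leq_addl.
elim: i => [|i IH] {}j kj oj.
  by apply: nth_default; apply: leq_trans (size_jacobi a k) _; rewrite addn0 in kj.
have [kj'|jk] := ltnP k j.
  by apply: nth_default; apply: leq_trans (size_jacobi a k) _.
have jk' : (j < k)%N.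
  by rewrite ltn_neqAle jk andbT; apply: contraTneq oj => ->; rewrite addnn odd_double.
have := jacobi_coef_rec a k j; rewrite (IH j.+2); last 2 first.
- by lia.
- by rewrite !addSn /= negbK.
rewrite mulr0 => /eqP; rewrite mulf_eq0 => /orP[|/eqP//].
by rewrite subr_eq0 lt_eqF// jacobi_eigen_lt.
Qed.

Lemma jacobi_atN1 a k : - 2^-1 <= a -> (jacobi a a k).[-1] ^+ 2 = (jacobi a a k).[1] ^+ 2.
Proof.
move=> a2.
suff -> : (jacobi a a k).[-1] = (-1) ^+ k * (jacobi a a k).[1] by rewrite exprMn sqrr_sign mul1r.
rewrite !horner_coef mulr_sumr; apply: eq_bigr => j _.
rewrite expr1n mulr1.
have [oj|] := boolP (odd (j + k)); first by rewrite jacobi_coef_odd// mul0r mulr0.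
by rewrite oddD -(signr_odd _ j) -(signr_odd _ k) negb_add => /eqP ->; rewrite mulrC.
Qed.

(* Sonin's function [E y^2 + (1 - x^2) y'^2] has derivative
   [2 (c - 1) x y'^2]. *)
Lemma sonin (E c : R) (y : {poly R}) x : 0 < E -> 1 <= c ->
  (1 - 'X^2) * y^`()^`() - c *: ('X * y^`()) + E *: y = 0 ->
  y.[-1] ^+ 2 = y.[1] ^+ 2 -> -1 <= x <= 1 -> y.[x] ^+ 2 <= y.[1] ^+ 2.
Proof.
move=> E0 c1 ode yN1 /andP[xN1 x1].
pose f : {poly R} := E *: (y * y) + (1 - 'X^2) * (y^`() * y^`()).
have fE t : f.[t] = E * y.[t] ^+ 2 + (1 - t ^+ 2) * (y^`()).[t] ^+ 2.
  by rewrite /f !(hornerD, hornerZ, hornerM, hornerN, hornerX, hornerC) !expr2.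
have f' t : (f^`()).[t] = 2 * (c - 1) * t * (y^`()).[t] ^+ 2.
  have := congr1 (fun p : {poly R} => 2 * (y^`()).[t] * p.[t]) ode.
  rewrite hornerC mulr0 /f !(derivD, derivZ, derivM, derivN, derivXn, derivC).
  rewrite !(hornerD, hornerN, hornerM, hornerZ, hornerC, hornerX, hornerMn, hornerXn) => H.
  by rewrite -[RHS]addr0 -[X in _ = _ + X]H; ring.
have df t : is_derive t (1 : R) (fun t => f.[t]) (f^`()).[t].
  apply: DeriveDef; first exact: derivable_horner.
  by rewrite -derive1E derivE.
have yf : E * y.[x] ^+ 2 <= f.[x].
  by rewrite fE lerDl mulr_ge0 ?sqr_ge0// subr_ge0; nra.
have f1 : f.[1] = E * y.[1] ^+ 2 by rewrite fE expr1n subrr mul0r addr0.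
have fN1 : f.[-1] = E * y.[1] ^+ 2.
  by rewrite fE sqrrN expr1n subrr mul0r addr0 yN1.
have c0 : 0 <= 2 * (c - 1) by lra.
rewrite -(ler_pM2l E0); apply: le_trans yf _.
have [x0|x0] := leP 0 x.
  rewrite -f1 -lerN2.
  apply: (@ler_nonpos_deriv R (fun t => - f.[t]) (fun t => - (f^`()).[t]) x 1 x1) => t /andP[tx t1].
  by rewrite oppr_le0 f' mulr_ge0 ?sqr_ge0// mulr_ge0// (le_trans x0).
rewrite -fN1.
apply: (@ler_nonpos_deriv R (fun t => f.[t]) (fun t => (f^`()).[t]) (-1) x xN1) => // t /andP[t1 tx].
rewrite f' mulr_le0_ge0 ?sqr_ge0// mulr_ge0_le0//.
by apply: le_trans tx (ltW x0).
Qed.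

(** Here [c = 2 (a + 1)], which is at least 1 exactly for [a >= -1/2]; [0 < k] makes the eigenvalue
    positive, and parity gives equal squares at both ends. *)
Lemma jacobi_sqr_le a k x : - 2^-1 <= a -> (0 < k)%N -> -1 <= x <= 1 ->
  (jacobi a a k).[x] ^+ 2 <= (jacobi a a k).[1] ^+ 2.
Proof.
move=> a2 k0 x1; apply: (sonin _ _ (jacobi_ode a k)) => //; last exact: jacobi_atN1.
  by have := jacobi_eigen_lt a2 k0; rewrite {1}/jacobi_eigen mul0r.
lra.
Qed.
End jacobi_parity.

(** * Orthogonality and weighted norms *)

Section jacobi_norm.
Context {R : realType}.
Implicit Types (a : R) (k j : nat).

(** Lagrange's identity: integrating the Wronskian [y' z - y z'] by parts leaves the difference of
    the eigenvalues times [y z], and the eigenvalues are distinct. *)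
Lemma jacobi_orthogonal a j k : - 2^-1 <= a -> j != k ->
  wint a (jacobi a a j * jacobi a a k) = 0.
Proof.
move=> a2 jk.
set y := jacobi a a j; set z := jacobi a a k.
have := wint_byparts (y^`() * z - y * z^`()) a2.
have -> : (1 - 'X^2) * (y^`() * z - y * z^`())^`()
    - (2 * (a + 1)) *: ('X * (y^`() * z - y * z^`())) =
    (jacobi_eigen a k - jacobi_eigen a j) *: (y * z).
  have oy := jacobi_ode a j; have oz := jacobi_ode a k.
  rewrite -/y -/z -!mul_polyC in oy oz *; move: y z oy oz => y z oy oz.
  rewrite derivB !derivM.
  transitivity (z * ((1 - 'X^2) * (y^`())^`() - (2 * (a + 1))%:P * ('X * y^`()) + (jacobi_eigen a j)%:P * y)
    - y * ((1 - 'X^2) * (z^`())^`() - (2 * (a + 1))%:P * ('X * z^`()) + (jacobi_eigen a k)%:P * z)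
    + (jacobi_eigen a k - jacobi_eigen a j)%:P * (y * z)); first by ring.
  by rewrite oy oz !mulr0 subrr add0r.
rewrite wintZ// => /eqP; rewrite mulf_eq0 => /orP[|/eqP//].
rewrite subr_eq0 => /eqP E; exfalso; move: jk; rewrite neq_ltn => /orP[] /(jacobi_eigen_lt a2).
  by rewrite E ltxx.
by rewrite E ltxx.
Qed.

Definition jacobi_norm2 a k := wint a (jacobi a a k * jacobi a a k).

(** By parts on [y y'], the integral of [(1 - x^2) y'^2] is the eigenvalue times that of [y^2]. The
    factor [1 - x^2] raises the parameter of the weight to the one that belongs to [y']. *)
Lemma jacobi_norm2S a k : - 2^-1 <= a ->
  jacobi_norm2 a k.+1 = (k%:R + 2 * a + 2) / (4 * k.+1%:R) * jacobi_norm2 (a + 1) k.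
Proof.
move=> a2; rewrite /jacobi_norm2.
set y := jacobi a a k.+1.
have := wint_byparts (y * y^`()) a2.
have -> : (1 - 'X^2) * (y * y^`())^`() - (2 * (a + 1)) *: ('X * (y * y^`())) =
    (1 - 'X^2) * (y^`() * y^`()) - jacobi_eigen a k.+1 *: (y * y).
  have oy := jacobi_ode a k.+1.
  rewrite -/y -!mul_polyC in oy *; move: y oy => y oy.
  rewrite !derivM.
  transitivity (y * ((1 - 'X^2) * (y^`())^`() - (2 * (a + 1))%:P * ('X * y^`()) + (jacobi_eigen a k.+1)%:P * y)
    + ((1 - 'X^2) * (y^`() * y^`()) - (jacobi_eigen a k.+1)%:P * (y * y))); first by ring.
  by rewrite oy mulr0 add0r.
rewrite wintB// wintZ// -wint_shift// jacobi_deriv.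
have a2' : - 2^-1 <= a + 1 by lra.
rewrite -scalerAl -scalerAr !wintZ// => /eqP; rewrite subr_eq0 => /eqP.
set h := wint (a + 1) _; set h' := wint a _ => E.
have k0 : (0 : R) <= k%:R by [].
have e0 : k%:R + 2 * a + 2 != 0 by rewrite gt_eqF//; lra.
have e1 : 1 + k%:R != 0 :> R by rewrite gt_eqF//; lra.
have en : jacobi_eigen a k.+1 != 0.
  rewrite /jacobi_eigen mulf_neq0// -?natr1 gt_eqF//; lra.
apply: (mulfI en); rewrite -E /jacobi_eigen -natr1.
by field.
Qed.

Lemma jacobi_norm20 a : jacobi_norm2 a 0 = jacobi_h0 a.
Proof.
rewrite /jacobi_norm2 -wint1; congr wint.
rewrite /jacobi big_ord_recl big_ord0 /= !expr0 bin0 !big_geq// fact0.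
by rewrite addr0 !mulr1 invr1 !scale1r mulr1.
Qed.

(** Integration by parts with [p = x]; it does the work of the Beta function formula. *)
Lemma jacobi_h0S a : - 2^-1 <= a ->
  (2 * a + 3) * jacobi_h0 (a + 1) = (2 * a + 2) * jacobi_h0 a.
Proof.
move=> a2; rewrite -!wint1 wint_shift// mulr1.
have := wint_byparts 'X a2; rewrite derivX mulr1.
have -> : 'X * 'X = 1 - (1 - 'X^2) :> {poly R} by rewrite subKr expr2.
by rewrite wintB// wintZ// [wint a (1 - _ )]wintB//; lra.
Qed.

Lemma jacobi_h0_gt0 a : - 2^-1 <= a -> 0 < jacobi_h0 a.
Proof.
move=> a2.
(* On [[-1/2, 1/2]], an interval of length 1, [1 - x^2] lies between 3/4 and 1. *)
pose m : R := Num.min ((3 / 4) `^ a) 1.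
have m0 : 0 < m by rewrite lt_min powR_gt0//=; lra.
apply: lt_le_trans m0 _.
rewrite /jacobi_h0.
have iw := integrable_jacobi_weight a2.
have sub : `[(- 2^-1 : R), 2^-1] `<=` `[(-1 : R), 1].
  by move=> x /=; rewrite !in_itv/= => /andP[h1 h2]; apply/andP; split; lra.
apply: (@le_trans _ _ (\int[lebesgue_measure]_(x in `[(- 2^-1 : R), 2^-1]) jacobi_weight a x)).
  apply: (@le_trans _ _ (\int[lebesgue_measure]_(x in `[(- 2^-1 : R), 2^-1]) m)).
    rewrite Rintegral_cst//= lebesgue_measure_itv/= lte_fin ifT; last by lra.
    by rewrite -EFinB /=; lra.
  apply: le_Rintegral => //.
  - by apply: continuous_compact_integrable; [exact: segment_compact|move=> x; exact: cvg_cst].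
  - by apply: integrableS iw => //.
  - move=> x /=; rewrite in_itv/= => /andP[x1 x2].
    have u1 : 3 / 4 <= 1 - x ^+ 2 by rewrite expr2; nra.
    have u2 : 1 - x ^+ 2 <= 1 by have := sqr_ge0 x; lra.
    rewrite /jacobi_weight ge_min; have [a0|a0] := leP 0 a; apply/orP.
      by left; apply: ge0_ler_powR => //; rewrite nnegrE; lra.
    right; apply: (@le_trans _ _ ((1 - x ^+ 2) `^ 0)); first by rewrite powRr0.
    apply: ger_powR; last exact: ltW.
    by rewrite u2 andbT; lra.
rewrite /Rintegral fine_le//.
- by apply: integrable_fin_num => //; apply: integrableS iw.
- by apply: integrable_fin_num.
- apply: ge0_subset_integral => //.
  + by apply/measurable_EFinP; apply: measurable_jacobi_weight.
  + by move=> x _; rewrite lee_fin jacobi_weight_ge0.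
Qed.

Lemma jacobi_norm2_gt0 a k : - 2^-1 <= a -> 0 < jacobi_norm2 a k.
Proof.
elim: k a => [|k IH] a a2; first by rewrite jacobi_norm20 jacobi_h0_gt0.
have k0 : (0 : R) <= k%:R by [].
rewrite jacobi_norm2S// mulr_gt0// ?IH//; last by lra.
by rewrite divr_gt0// ?mulr_gt0// ?ltr0n//; lra.
Qed.
End jacobi_norm.

(** * Sup norm of the normalised polynomials *)

Section jacobi_sup.
Context {R : realType}.
Implicit Types (a : R) (k : nat).

Lemma jacobi_at1S a k :
  (jacobi a a k.+1).[1] = (a + 1) / k.+1%:R * (jacobi (a + 1) (a + 1) k).[1].
Proof.
rewrite !jacobi_at1 big_ltn// big_add1 /= factS natrM.
rewrite (eq_bigr (fun i => a + 1 + i%:R)) => [|i _]; last by rewrite -natr1; ring.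
have f0 : (k`!%:R : R) != 0 by rewrite pnatr_eq0 -lt0n fact_gt0.
have k0 : (1 + k%:R : R) != 0 by rewrite nat1r.
by rewrite -natr1; field; rewrite f0 k0.
Qed.

(** The recursions lower the degree and raise the parameter, so the induction is over all [a]. It
    starts at degree 1, because the closed form does not give the ratio 1 at degree 0 in general. *)
Lemma jacobi_ratio a k : - 2^-1 <= a ->
  jacobi_h0 a * (jacobi a a k.+1).[1] ^+ 2 * k.+1`!%:R =
  jacobi_norm2 a k.+1 *
    ((2 * k.+1%:R + (2 * a + 1)) * \prod_(1 <= i < k.+1) (2 * a + 1 + i%:R)).
Proof.
elim: k a => [|k IH] a a2; have a2' : - 2^-1 <= a + 1 by lra.
  have e0 : 2 * a + 3 != 0 by rewrite gt_eqF//; lra.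
  rewrite jacobi_at1S jacobi_norm2S// jacobi_norm20 big_geq// mulr1 /= factS fact0 muln1 mulr1.
  rewrite jacobi_at1 big_geq// fact0.
  have -> : jacobi_h0 (a + 1) = (2 * a + 2) * jacobi_h0 a / (2 * a + 3).
    by rewrite -jacobi_h0S// mulrAC divff ?mul1r.
  by field.
have e2 : 2 * a + 2 != 0 by rewrite gt_eqF//; lra.
have k0 : (1 + k.+1%:R : R) != 0 by rewrite nat1r.
rewrite jacobi_at1S jacobi_norm2S// factS natrM.
have -> : jacobi_h0 a = (2 * a + 3) / (2 * a + 2) * jacobi_h0 (a + 1).
  by rewrite mulrAC jacobi_h0S// mulrAC divff ?mul1r.
transitivity ((2 * a + 3) * (a + 1) / (2 * k.+2%:R) *
  (jacobi_h0 (a + 1) * (jacobi (a + 1) (a + 1) k.+1).[1] ^+ 2 * k.+1`!%:R)).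
  have -> : a + 1 = (2 * a + 2) / 2 by field.
  rewrite -(natr1 k.+1); set z := (jacobi _ _ _).[1]; set h := jacobi_h0 _.
  by field; rewrite nat1r natr1 pnatr_eq0 e2.
rewrite IH//.
(* Both sides are the product of [2a + 1 + i] up to [k + 2], peeled at the last factor on the left
   and at the first two on the right. *)
have P1 : \prod_(1 <= i < k.+2) (2 * a + 1 + i%:R) * (k.+2%:R + 2 * a + 1) =
   (2 * a + 2) * (2 * a + 3) * \prod_(1 <= i < k.+1) (2 * (a + 1) + 1 + i%:R).
  transitivity (\prod_(1 <= i < k.+3) (2 * a + 1 + i%:R)).
    by rewrite [RHS]big_nat_recr//=; congr (_ * _); ring.
  rewrite big_ltn// big_ltn// !big_add1 /= mulrA; congr (_ * _); first by ring.
  by apply: eq_bigr => i _; rewrite -!natr1; ring.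
set p := \prod_(1 <= i < k.+2) _ in P1 *; set q := \prod_(1 <= i < k.+1) _ in P1 *.
transitivity (jacobi_norm2 (a + 1) k.+1 * (2 * k.+2%:R + (2 * a + 1)) / (4 * k.+2%:R) *
   ((2 * a + 2) * (2 * a + 3) * q)).
  by rewrite -!natr1; field; rewrite ?k0 -?natr1 addrC.
rewrite -P1 -!natr1; field.
by rewrite ?natr1 ?nat1r.
Qed.

(** The product of [1 + A/i] is at most [e^(A H_k)] with [H_k <= 1 + ln k]. The induction avoids
    harmonic numbers through [1 + A/n <= e^(A/n)] and [e^(1/n) (n - 1) <= n]. *)
Lemma prod_le_expR_powR (A : R) k : 0 <= A -> (0 < k)%N ->
  (\prod_(1 <= i < k.+1) (A + i%:R)) <= k`!%:R * (expR A * k%:R `^ A).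
Proof.
move=> A0; case: k => // k _; elim: k => [|k IH].
  by rewrite big_nat1 factS fact0 muln1 powR1 mul1r mulr1 addrC expR_ge1Dx.
rewrite big_nat_recr//= factS natrM.
have kp : 0 < k.+1%:R :> R by rewrite ltr0n.
have kp2 : 0 < k.+2%:R :> R by rewrite ltr0n.
apply: (@le_trans _ _ (k.+1`!%:R * (expR A * k.+1%:R `^ A) * (A + k.+2%:R))).
  by apply: ler_wpM2r => //; rewrite addr_ge0.
rewrite [k.+2%:R * _]mulrC -!mulrA ler_wpM2l// [k.+2%:R * _]mulrCA ler_wpM2l ?expR_ge0//.
have step : expR (A / k.+2%:R) * k.+1%:R `^ A <= k.+2%:R `^ A.
  have h : expR (1 / k.+2%:R) * k.+1%:R <= k.+2%:R :> R.
    have := @expR_ge1Dx R (- (1 / k.+2%:R)).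
    rewrite expRN -[leRHS]mul1r ler_pdivlMr ?expR_gt0// => h.
    have : (1 + - (1 / k.+2%:R)) * k.+2%:R = k.+1%:R :> R.
      by rewrite -(natr1 k.+1); field; rewrite nat1r.
    move=> <-; rewrite mulrA -[leRHS]mul1r.
    by apply: ler_wpM2r; [exact: ltW|rewrite mulrC].
  apply: (@le_trans _ _ ((expR (1 / k.+2%:R) * k.+1%:R) `^ A)); last first.
    by apply: ge0_ler_powR => //; rewrite nnegrE ?mulr_ge0 ?expR_ge0// ltW.
  rewrite powRM ?expR_ge0 ?(ltW kp)// -expRM ler_wpM2r ?powR_ge0//.
  by rewrite ler_expR mul1r mulrC.
have : (1 + A / k.+2%:R) * k.+1%:R `^ A <= k.+2%:R `^ A.
  apply: le_trans step; apply: ler_wpM2r; [exact: powR_ge0|exact: expR_ge1Dx].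
move=> /(ler_wpM2l (ltW kp2)); rewrite mulrA (_ : k.+2%:R * (1 + A / k.+2%:R) = A + k.+2%:R); last first.
  by field; rewrite gt_eqF.
by rewrite mulrC.
Qed.

Lemma njacobiE a k : njacobi a k = (Num.sqrt (jacobi_norm2 a k))^-1 *: jacobi a a k.
Proof.
rewrite /njacobi; congr ((Num.sqrt _)^-1 *: _).
by apply: eq_Rintegral => x _; rewrite hornerM expr2.
Qed.

Lemma wint_njacobi a j k : - 2^-1 <= a ->
  wint a (njacobi a j * njacobi a k) = (j == k)%:R.
Proof.
move=> a2; rewrite !njacobiE -scalerAl -scalerAr !wintZ//.
have [->|jk] := eqVneq j k; last by rewrite jacobi_orthogonal// !mulr0.
have h := jacobi_norm2_gt0 k a2.
rewrite -/(jacobi_norm2 a k) mulrA -expr2 exprVn sqr_sqrtr ?mulVf ?gt_eqF//.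
exact: ltW.
Qed.

Lemma njacobi0 a : njacobi a 0 = ((Num.sqrt (jacobi_h0 a))^-1)%:P.
Proof.
rewrite njacobiE jacobi_norm20 /jacobi big_ord_recl big_ord0 /= !expr0 bin0 !big_geq// fact0.
by rewrite addr0 !mulr1 invr1 !scale1r alg_polyC.
Qed.

Lemma Dconst_ge1 N a : (0 < N)%N -> - 2^-1 <= a -> 1 <= Dconst N a :> R.
Proof.
move=> N0 a2; rewrite /Dconst; case: ifP => _; first by lra.
have N1 : 1 <= N%:R :> R by rewrite ler1n.
have pi1 : 1 <= pi :> R by have := @pi_ge2 R; lra.
have p1 : 1 <= pi `^ (3 / 4) :> R.
  by rewrite -[leLHS](powRr0 pi); apply: ler_powR => //; lra.
have p2 : 1 <= N%:R `^ (a + 2^-1) :> R.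
  by rewrite -[leLHS](powRr0 N%:R); apply: ler_powR => //; lra.
have p3 : 1 <= expR (a + 3 / 4) by rewrite -[leLHS]expR0 ler_expR; lra.
by rewrite -[leLHS]mul1r ler_pM// -[leLHS]mul1r ler_pM.
Qed.

(** For [a] above -1/2 the right side is larger by the factor [pi^(3/2) e^(1/2) / 2], for which
    [pi >= 2] suffices; at -1/2 the claim is [2 <= 4]. *)
Lemma Dconst_sqr_ge N a : (0 < N)%N -> - 2^-1 <= a ->
  2 * (expR (2 * a + 1) * N%:R `^ (2 * a + 1)) <= Dconst N a ^+ 2.
Proof.
move=> N0 a2; rewrite /Dconst; case: eqP => [->|_].
  by rewrite mulrN divff// addNr expR0 powRr0 !mulr1 expr2; lra.
rewrite !exprMn.
have -> : (N%:R `^ (a + 2^-1)) ^+ 2 = N%:R `^ (2 * a + 1) :> R.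
  by rewrite -powR_mulrn ?powR_ge0// -powRrM; congr (_ `^ _); field.
have -> : expR (a + 3 / 4) ^+ 2 = expR (2 * a + 1) * expR (1 / 2).
  by rewrite -expRM_natl -expRD; congr expR; field.
have p2 : 2 <= (pi `^ (3 / 4)) ^+ 2 :> R.
  rewrite -powR_mulrn ?powR_ge0// -powRrM.
  have pi2 := @pi_ge2 R; apply: le_trans pi2 _.
  by rewrite -[leLHS]powRr1 ?pi_ge0//; apply: ler_powR; [by apply: le_trans (pi_ge2 R); rewrite ler1n|lra].
have e1 : 1 <= expR (1 / 2) :> R by rewrite -[leLHS]expR0 ler_expR; lra.
rewrite [_ * expR (1 / 2)]mulrC [expR (1 / 2) * _]mulrC [X in _ <= X]mulrA.
rewrite -[leLHS]mulr1 ler_pM// ?mulr_ge0 ?expR_ge0 ?powR_ge0//.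
rewrite -mulrA ler_pM ?mulr_ge0 ?expR_ge0 ?powR_ge0//.
by rewrite mulrC.
Qed.

Lemma njacobi_sup N a k x : - 2^-1 <= a -> (0 < k)%N -> (k <= N)%N -> -1 <= x <= 1 ->
  jacobi_h0 a * (njacobi a k).[x] ^+ 2 <= Dconst N a ^+ 2.
Proof.
move=> a2 k0 kN x1.
have h0 := jacobi_h0_gt0 a2; have nk := jacobi_norm2_gt0 k a2.
rewrite njacobiE hornerZ exprMn exprVn sqr_sqrtr ?(ltW nk)//.
rewrite mulrCA mulrC ler_pdivrMr//.
have f0 : 0 < k`!%:R :> R by rewrite ltr0n fact_gt0.
apply: le_trans (_ : jacobi_h0 a * (jacobi a a k).[1] ^+ 2 <= _).
  by rewrite ler_pM2l// jacobi_sqr_le.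
rewrite -(ler_pM2r f0).
have A0 : 0 <= 2 * a + 1 by lra.
have := jacobi_ratio k.-1 a2; rewrite prednK// => ->.
rewrite [leRHS]mulrAC [leRHS]mulrC ler_pM2l//.
(* [2k + A <= 2 (A + k)], with [A = 2a + 1], supplies the missing last factor of the product. *)
apply: (@le_trans _ _ (2 * \prod_(1 <= i < k.+1) (2 * a + 1 + i%:R))).
  rewrite big_nat_recr//= [_ * (_ + k%:R)]mulrC mulrA ler_wpM2r//.
    by rewrite prodr_ge0// => i _; rewrite addr_ge0.
  by lra.
apply: (@le_trans _ _ (2 * (k`!%:R * (expR (2 * a + 1) * k%:R `^ (2 * a + 1))))).
  by rewrite ler_pM2l// prod_le_expR_powR.
rewrite mulrCA mulrC ler_pM2r//.
apply: le_trans (Dconst_sqr_ge (leq_trans k0 kN) a2).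
rewrite ler_pM2l// ler_pM2l ?expR_gt0//.
by apply: ge0_ler_powR; rewrite ?nnegrE// ler_nat.
Qed.
End jacobi_sup.

(** * Densities and Lebesgue measure on tuples *)

Section density.
Local Open Scope ereal_scope.
Context d (T : measurableType d) (R : realType)
  (mu nu : {measure set T -> \bar R}) (g : T -> R).
Hypothesis g0 : forall x, (0 <= g x)%R.
Hypothesis mg : measurable_fun setT g.
Hypothesis nuE : forall A, measurable A -> nu A = \int[mu]_(x in A) (g x)%:E.
Import HBNNSimple.

Let indicE (A : set T) (r : R) : measurable A -> (0 <= r)%R ->
  \int[mu]_x ((r * \1_A x)%:E * (g x)%:E) = \int[nu]_x (r * \1_A x)%:E.
Proof.
move=> mA r0.
have mI : measurable_fun setT (fun x => (\1_A x)%:E : \bar R) by exact/measurable_EFinP.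
under [RHS]eq_integral do rewrite EFinM.
rewrite ge0_integralZl// ?lee_fin//.
rewrite integral_indic// setIT nuE//.
under eq_integral do rewrite EFinM -muleA.
rewrite ge0_integralZl//; last first.
- by move=> x _; rewrite mule_ge0 ?lee_fin.
- by apply: emeasurable_funM => //; exact/measurable_EFinP.
congr (_ * _); rewrite [RHS]integral_mkcond; apply: eq_integral => x _.
by rewrite epatch_indic muleC.
Qed.

Let nnsfunE (h : {nnsfun T >-> R}) :
  \int[mu]_x ((h x)%:E * (g x)%:E) = \int[nu]_x (h x)%:E.
Proof.
have mterm r : measurable_fun setT (fun x => (r * \1_(h @^-1` [set r]) x)%:E : \bar R).
  by apply/measurable_EFinP; exact: measurable_funM.
under [RHS]eq_integral do rewrite fimfunE -fsumEFin//.
rewrite ge0_integral_fsum//; last by move=> r x _; exact: nnfun_muleindic_ge0.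
transitivity (\int[mu]_x (\sum_(r \in range h) (r * \1_(h @^-1` [set r]) x)%:E * (g x)%:E)).
  apply: eq_integral => x _.
  rewrite -ge0_mule_fsuml => [|r]; last exact: nnfun_muleindic_ge0.
  by rewrite fsumEFin// -fimfunE.
rewrite ge0_integral_fsum//; last 2 first.
- by move=> r; apply: emeasurable_funM => //; exact/measurable_EFinP.
- by move=> r x _; apply: mule_ge0; [exact: nnfun_muleindic_ge0|rewrite lee_fin].
apply: eq_fsbigr => r; rewrite inE => -[t _ <-].
by apply: indicE.
Qed.

(** [nuE] is the case of indicators; simple functions and monotone convergence extend it. *)
Lemma ge0_integral_density (f : T -> \bar R) : (forall x, 0 <= f x) ->
  measurable_fun setT f -> \int[nu]_x f x = \int[mu]_x (f x * (g x)%:E).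
Proof.
move=> f0 mf; pose h := nnsfun_approx measurableT mf.
have hf x : (h n x)%:E @[n --> \oo] --> f x by exact: cvg_nnsfun_approx.
have nd x : {homo (fun n => (h n x)%:E) : a b / (a <= b)%N >-> a <= b}.
  by move=> a b ab; rewrite lee_fin; exact/lefP/nd_nnsfun_approx.
have mg' : measurable_fun setT (EFin \o g) by exact/measurable_EFinP.
transitivity (limn (fun n => \int[nu]_x (h n x)%:E)).
  rewrite -monotone_convergence//.
  - by apply: eq_integral => x _; apply/esym/cvg_lim.
  - by move=> n; exact/measurable_EFinP.
  - by move=> n x _; rewrite lee_fin.
transitivity (limn (fun n => \int[mu]_x ((h n x)%:E * (g x)%:E))).
  by congr (limn _); apply/funext => n; rewrite nnsfunE.
rewrite -monotone_convergence//.
- apply: eq_integral => x _; apply/cvg_lim => //.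
  by apply: cvgeZr.
- by move=> n; apply: emeasurable_funM => //; exact/measurable_EFinP.
- by move=> n x _; rewrite mule_ge0 ?lee_fin.
- by move=> x _ a b ab; rewrite lee_wpmul2r ?lee_fin//; exact: nd.
Qed.
End density.
Section bounded_density.
Context d (T : measurableType d) (R : realType)
  (mu : {measure set T -> \bar R}) (P : probability T R) (g : T -> R).
Hypothesis g0 : forall x, 0 <= g x.
Hypothesis mg : measurable_fun setT g.
Hypothesis PE : forall A, measurable A -> P A = (\int[mu]_(x in A) (g x)%:E)%E.

Lemma Rintegral_density (f : T -> R) : bounded_rv f ->
  \int[P]_x f x = \int[mu]_x (f x * g x).
Proof.
move=> [mf [c fc]].
have ig1 : (\int[mu]_x (g x)%:E = 1)%E by rewrite -PE// probability_setT.
have ig : mu.-integrable setT (EFin \o g).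
  apply/integrableP; split; first exact/measurable_EFinP.
  under eq_integral do rewrite /= ger0_norm//.
  by rewrite ig1 ltry.
have ifg : mu.-integrable setT (EFin \o (fun x => f x * g x)).
  have icg : mu.-integrable setT (fun x => c%:E * (g x)%:E)%E by exact: integrableZl.
  apply: (le_integrable _ _ _ icg) => //.
    by apply/measurable_EFinP; exact: measurable_funM.
  move=> x _; rewrite /= lee_fin !normrM ler_wpM2r//.
  by apply: le_trans (fc x) (ler_norm _).
have icg : mu.-integrable setT (EFin \o (fun x => c * g x)).
  by apply: eq_integrable (integrableZl _ c ig).
have bf : bounded_rv f by split => //; exists c.
(* [f + c] is nonnegative, and the constant cancels because [g] has integral 1. *)
have := @ge0_integral_density _ _ _ mu P g g0 mg PE (fun x => (f x + c)%:E).
move=> /(_ _ _)/(congr1 fine) H.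
have H1 : \int[P]_x (f x + c) = \int[mu]_x ((f x + c) * g x).
  apply: H => [x|]; first by have := fc x; rewrite ler_norml lee_fin => /andP[+ _]; lra.
  by apply/measurable_EFinP; exact: measurable_funD.
have : \int[P]_x f x + c = \int[mu]_x (f x * g x) + c; last by move/addIr.
have <- : \int[P]_x (f x + c) = \int[P]_x f x + c.
  rewrite RintegralD//; try exact: bounded_rv_integrable.
    rewrite Rintegral_cst// [X in fine X](_ : _ = 1%E) ?mulr1//; exact: probability_setT.
  exact/bounded_rv_integrable/bounded_rv_cst.
rewrite H1; under eq_Rintegral do rewrite mulrDl.
rewrite RintegralD// RintegralZl//; congr (_ + _).
by rewrite /Rintegral ig1 mulr1.
Qed.
End bounded_density.

(** * Product integrals on tuples *)

Section with_sigma_finite.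
Context d (T : measurableType d) (R : realType) (mu : {measure set T -> \bar R})
  (sf : sigma_finite setT mu).

(** An alias that takes the proof of sigma-finiteness as an argument, so that the structure can be
    attached to a measure computed by a fixpoint such as [lebesgue_tuple n]. *)
Definition with_sigma_finite of sigma_finite setT mu : set T -> \bar R := mu.

HB.instance Definition _ := Measure.copy (with_sigma_finite sf) mu.
HB.instance Definition _ := @Measure_isSigmaFinite.Build _ _ _ (with_sigma_finite sf) sf.

End with_sigma_finite.

Section product_integral.
Local Open Scope ereal_scope.
Context d1 d2 (T1 : measurableType d1) (T2 : measurableType d2) (R : realType).
Context (m1 : {sigma_finite_measure set T1 -> \bar R})
  (m2 : {sigma_finite_measure set T2 -> \bar R}) (f : T1 -> R) (g : T2 -> R).
Hypothesis fi : m1.-integrable setT (EFin \o f).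
Hypothesis gi : m2.-integrable setT (EFin \o g).

Let mfg : measurable_fun setT (fun z : T1 * T2 => (f z.1 * g z.2)%:E).
Proof.
apply/measurable_EFinP; apply: measurable_funM; apply: measurableT_comp => //.
  by apply/measurable_EFinP; exact: measurable_int fi.
by apply/measurable_EFinP; exact: measurable_int gi.
Qed.

Lemma integrable_prod_meas : (m1 \x m2).-integrable setT (fun z => (f z.1 * g z.2)%:E).
Proof.
apply/(integrable12ltyP _ _ mfg).
have [mf fi1] := integrableP _ _ _ fi; have [mg gi1] := integrableP _ _ _ gi.
under eq_integral do under eq_integral do rewrite /= normrM EFinM.
have mnf : measurable_fun setT (fun x => `|f x|%:E) by apply/measurable_EFinP; apply: measurableT_comp => //; exact/measurable_EFinP.
have mng : measurable_fun setT (fun x => `|g x|%:E) by apply/measurable_EFinP; apply: measurableT_comp => //; exact/measurable_EFinP.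
have E x : \int[m2]_y (`|f x|%:E * `|g y|%:E) = `|f x|%:E * \int[m2]_y `|g y|%:E.
  by rewrite ge0_integralZl// => y _; rewrite lee_fin.
under eq_integral do rewrite E.
rewrite ge0_integralZr//; last by apply: integral_ge0 => y _; rewrite lee_fin.
apply: lte_mul_pinfty => //; first by apply: integral_ge0 => y _; rewrite lee_fin.
by rewrite ge0_fin_numE//; apply: integral_ge0 => y _; rewrite lee_fin.
Qed.

Lemma Rintegral_prod_meas : (\int[m1 \x m2]_z (f z.1 * g z.2) =
  \int[m1]_x f x * \int[m2]_y g y)%R.
Proof.
apply: EFin_inj; rewrite EFinM /Rintegral !fineK; try exact: integrable_fin_num.
  rewrite -(integral12_prod_meas1 integrable_prod_meas) /fubini_F /=.
  have E x : \int[m2]_y (f x * g y)%:E = (f x)%:E * \int[m2]_y (g y)%:E.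
    by under eq_integral do rewrite EFinM; rewrite integralZl.
  under eq_integral do rewrite E.
  have := integrable_fin_num _ gi; move=> /(_ measurableT) /fineK <-.
  by rewrite integralZr.
by apply: integrable_fin_num => //; exact: integrable_prod_meas.
Qed.

End product_integral.

Section tuple_fubini.
Context {R : realType}.
Notation leb := (@lebesgue_measure R).

Let box n (k : nat) : set (n.-tuple R) := [set x | forall i, tnth x i \in `[- k%:R, k%:R]].

Let measurable_box n k : measurable (@box n k).
Proof.
rewrite (_ : @box n k = \bigcap_(i in [set: 'I_n]) (fun x => tnth x i) @^-1` `[- k%:R, k%:R]).
  apply: fin_bigcap_measurable => // i _; rewrite -[X in measurable X]setTI.
  by apply: measurable_tnth => //; exact: measurable_itv.
by apply/seteqP; split=> [x h i _|x h i]; [exact: h|exact: (h i I)].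
Qed.

Let tcons_box n k : @tcons R n @^-1` @box n.+1 k = @box n k `*` `[- k%:R, k%:R].
Proof.
apply/seteqP; split=> [[t x] /= h|[t x] /= [h hx] i].
  split=> [i|]; last exact: (h ord0).
  by have := h (lift ord0 i); rewrite tnthS.
have [->|[j ->]] : i = ord0 \/ exists j, i = lift ord0 j.
  by case: (unliftP ord0 i) => [j ->|->]; [right; exists j|left].
  exact: hx.
by rewrite tnthS; exact: h.
Qed.

Lemma sigma_finite_lebesgue_tuple n : sigma_finite setT (@lebesgue_tuple R n).
Proof.
exists (@box n).
  apply/esym/seteqP; split => // x _.
  (* An integer above the sum of the moduli is above each of them. *)
  exists (Num.bound (\sum_i `|tnth x i|)) => // i; rewrite in_itv/= -ler_norml.
  apply: le_trans (ltW (archi_boundP _)); last exact: sumr_ge0.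
  by rewrite (bigD1 i)//= lerDl sumr_ge0.
move=> k; split; first exact: measurable_box.
elim: n => [|n IH] /=; first by rewrite diracE; case: (_ \in _); rewrite ltry.
rewrite /cons_measure /pushforward tcons_box product_measure1E//; last exact: measurable_box.
apply: lte_mul_pinfty => //.
  by rewrite ge0_fin_numE.
have : (@lebesgue_measure R `[(- k%:R)%R, (k%:R)%R]%classic < +oo)%E; last by [].
by rewrite lebesgue_measure_itv/=; case: ifP => _; rewrite -?EFinB ltry.
Qed.

Lemma integral_lebesgue_tuple n (g : 'I_n -> R -> R) :
  (forall l, leb.-integrable setT (EFin \o g l)) ->
  (lebesgue_tuple n).-integrable setT (EFin \o (fun x : n.-tuple R => \prod_l g l (tnth x l))) /\
  \int[lebesgue_tuple n]_x (\prod_l g l (tnth x l)) = \prod_l \int[leb]_x g l x.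
Proof.
elim: n g => [|n IH] g ig.
  have E : (fun x : 0.-tuple R => \prod_l g l (tnth x l)) = fun=> 1.
    by apply/funext => x; rewrite big_ord0.
  rewrite E big_ord0; split.
    by apply: measurable_bounded_integrable => //=; [rewrite diracT ltry|exact: bounded_cst].
  by rewrite Rintegral_cst// [X in fine X](_ : _ = 1%E) ?mulr1//; exact: diracT.
(* Convertible to [lebesgue_tuple n], with the sigma-finiteness that Fubini requires. *)
pose m1 : {sigma_finite_measure set _ -> \bar R} := with_sigma_finite (sigma_finite_lebesgue_tuple n).
have [iG EG] := IH (fun l => g (lift ord0 l)) (fun l => ig _).
pose G (t : n.-tuple R) := \prod_l g (lift ord0 l) (tnth t l).
pose f (x : n.+1.-tuple R) := \prod_l g l (tnth x l).
have ml l : measurable_fun setT (g l) by apply/measurable_EFinP; exact: measurable_int (ig l).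
have mf : measurable_fun setT f.
  apply: measurable_prod => l _; apply: measurableT_comp => //; exact: measurable_tnth.
have fE z : f (tcons z) = G z.1 * g ord0 z.2.
  rewrite /f big_ord_recl mulrC; congr (_ * _).
  by apply: eq_bigr => l _; congr (g _ _); rewrite /tcons /= !(tnth_nth 0).
have mG : measurable_fun setT G by apply/measurable_EFinP; exact: measurable_int iG.
have mh : measurable_fun setT (fun z : n.-tuple R * R => (G z.1 * g ord0 z.2)%:E).
  by apply/measurable_EFinP; apply: measurable_funM; apply: measurableT_comp.
have ih : (pushforward (m1 \x leb)%E (@tcons R n)).-integrable setT (EFin \o f).
  apply: integrable_pushforward => //; first exact: measurable_tcons.
    exact/measurable_EFinP.
  rewrite (_ : _ \o _ = (fun z => (G z.1 * g ord0 z.2)%:E)).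
    exact: (@integrable_prod_meas _ _ _ _ _ m1 leb).
  by apply/funext => z; rewrite /= fE.
have fEc : (EFin \o f) \o @tcons R n = (fun z => (G z.1 * g ord0 z.2)%:E).
  by apply/funext => z; rewrite /= fE.
have ic := @integrable_prod_meas _ _ _ _ _ m1 leb G (g ord0) iG (ig ord0).
split=> //; rewrite big_ord_recl mulrC -EG.
apply: etrans (@Rintegral_prod_meas _ _ _ _ _ m1 leb G (g ord0) iG (ig ord0)).
congr fine.
transitivity (\int[pushforward (m1 \x leb) (@tcons R n)]_x (f x)%:E)%E; first by [].
rewrite integral_pushforward//; last 3 first.
- exact: measurable_tcons.
- exact/measurable_EFinP.
- by rewrite fEc.
by rewrite preimage_setT fEc.
Qed.
End tuple_fubini.

(** * The tensor basis *)

Section basis_features.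
Context {R : realType}.
Implicit Types (a : R).

(** Orthonormal for the probability density [jacobi_weight / jacobi_h0], so that degree 0 gives the
    constant 1. *)
Definition qjacobi a k : {poly R} := Num.sqrt (jacobi_h0 a) *: njacobi a k.

(* The cut-off makes it bounded on the whole line; the samples lie in the cube. *)
Definition clipped a k (t : R) : R := (qjacobi a k).[t] * \1_`[-1, 1] t.

(** Coordinates with [k l = 0] contribute 1 on the cube, so the product runs over all coordinates
    and [u] is left out. *)
Definition clipped_basis a d (k : {ffun 'I_d -> nat}) (x : d.-tuple R) : R :=
  \prod_l clipped a (k l) (tnth x l).

Lemma qjacobi0 a : - 2^-1 <= a -> qjacobi a 0 = 1.
Proof.
move=> a2; rewrite /qjacobi njacobi0 -mul_polyC -polyCM divff//.
by rewrite gt_eqF// sqrtr_gt0 jacobi_h0_gt0.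
Qed.

Lemma wint_qjacobi a j k : - 2^-1 <= a ->
  wint a (qjacobi a j * qjacobi a k) = jacobi_h0 a * (j == k)%:R.
Proof.
move=> a2; rewrite /qjacobi -scalerAl -scalerAr !wintZ// wint_njacobi//.
by rewrite mulrA -expr2 sqr_sqrtr// ltW// jacobi_h0_gt0.
Qed.

Lemma bounded_clipped a k : bounded_rv (clipped a k).
Proof.
split.
  by apply: measurable_funM; [exact: measurable_horner|exact: measurable_indic].
have [c hc] := horner_bounded (qjacobi a k).
exists `|c| => t; rewrite /clipped indicE.
have [|_] := boolP (t \in _); last by rewrite mulr0 normr0.
rewrite inE/= in_itv/= mulr1 => /hc /le_trans; apply; exact: ler_norm.
Qed.

Lemma bounded_clipped_basis a d (k : {ffun 'I_d -> nat}) : bounded_rv (clipped_basis a k).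
Proof.
apply: bounded_rv_prod => l; have [mc [c hc]] := bounded_clipped a (k l).
split; last by exists c.
by apply: measurableT_comp => //; exact: measurable_tnth.
Qed.

Lemma clipped_sqr_le a k N t : - 2^-1 <= a -> (0 < k <= N)%N ->
  clipped a k t ^+ 2 <= Dconst N a ^+ 2.
Proof.
move=> a2 /andP[k0 kN]; rewrite /clipped indicE.
have [|_] := boolP (t \in _); last by rewrite mulr0 expr0n sqr_ge0.
rewrite inE/= in_itv/= mulr1 => t1.
rewrite /qjacobi hornerZ exprMn sqr_sqrtr ?(ltW (jacobi_h0_gt0 a2))//.
exact: njacobi_sup.
Qed.

Lemma clipped0_sqr_le a t : - 2^-1 <= a -> clipped a 0 t ^+ 2 <= 1.
Proof.
move=> a2; rewrite /clipped qjacobi0// hornerC mul1r indicE.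
by case: (_ \in _); rewrite ?expr1n ?expr0n.
Qed.

(** At most [m] factors have positive degree, each with square at most [D^2]; [Dconst_ge1] pads
    their number to [m]. *)
Lemma clipped_basis_sqr_le a d N m (uk : {set 'I_d} * {ffun 'I_d -> nat}) x :
  - 2^-1 <= a -> (0 < N)%N -> basis_index d N m uk ->
  clipped_basis a uk.2 x ^+ 2 <= Dconst N a ^+ (2 * m).
Proof.
move=> a2 N0 [ku k0 um kN].
rewrite /clipped_basis -prodrXl.
have D1 := Dconst_ge1 N0 a2.
apply: (@le_trans _ _ (\prod_(l | l \in uk.1) Dconst N a ^+ 2)).
  rewrite [leRHS]big_mkcond/=; apply: ler_prod => l _; rewrite sqr_ge0 /=.
  case: ifPn => lu; last by rewrite k0// clipped0_sqr_le.
  apply: clipped_sqr_le => //; rewrite ku//=.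
  by apply: leq_trans kN; rewrite (bigD1 l)//= leq_addr.
by rewrite prodr_const -exprM ler_weXn2l// leq_mul.
Qed.

Lemma clipped_basisE a d N m (uk : {set 'I_d} * {ffun 'I_d -> nat}) x :
  - 2^-1 <= a -> basis_index d N m uk -> cube d x ->
  clipped_basis a uk.2 x = Num.sqrt (jacobi_h0 a ^+ d) * Phi a uk.1 uk.2 x.
Proof.
move=> a2 [ku k0 um kN] cx.
have h0 := jacobi_h0_gt0 a2.
rewrite /clipped_basis /Phi.
transitivity (\prod_(l | l \in uk.1) (Num.sqrt (jacobi_h0 a) * (njacobi a (uk.2 l)).[tnth x l])).
  rewrite [RHS]big_mkcond/=; apply: eq_bigr => l _.
  have xl : tnth x l \in (`[-1, 1]%classic : set R) by rewrite inE/= in_itv/=; exact: cx.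
  rewrite /clipped indicE xl mulr1; case: ifPn => lu; first by rewrite hornerZ.
  by rewrite k0// qjacobi0// hornerC.
rewrite big_split /= prodr_const mulrA; congr (_ * _).
rewrite -!powR12_sqrt ?exprn_ge0 ?(ltW h0)//.
rewrite -[jacobi_h0 a ^+ d]powR_mulrn ?(ltW h0)// -powRrM.
rewrite -[LHS]powR_mulrn ?powR_ge0// -powRrM -powRD; last by apply/implyP => _; rewrite gt_eqF.
by congr (_ `^ _); field.
Qed.

(** [u] is recovered as the support of [k], so orthogonality can be decided on multi-indices
    alone. *)
Lemma basis_index_inj d N m (uk uk' : {set 'I_d} * {ffun 'I_d -> nat}) :
  basis_index d N m uk -> basis_index d N m uk' -> uk.2 = uk'.2 -> uk = uk'.
Proof.
move=> [ku k0 _ _] [ku' k0' _ _]; case: uk uk' ku k0 ku' k0' => [u k] [u' k'] /= ku k0 ku' k0' E.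
rewrite {}E in ku k0 *; congr pair; apply/setP => l.
apply/idP/idP => lu; apply: contraTT lu => lu.
  by apply/negP => /ku; rewrite k0'.
by apply/negP => /ku'; rewrite k0.
Qed.
End basis_features.

(** * Orthonormality under the sampling density *)

Section orthonormality.
Context {R : realType}.
Implicit Types (a : R).

Let u a k k' (t : R) := clipped a k t * clipped a k' t * (jacobi_weight a t / jacobi_h0 a).

Let uE a k k' : u a k k' =
  (fun t => ((qjacobi a k * qjacobi a k').[t] * jacobi_weight a t) / jacobi_h0 a) \_ `[-1, 1].
Proof.
apply/funext => t; rewrite /u /clipped patchE indicE hornerM.
by case: (_ \in _); rewrite ?mulr1 ?mulr0 ?mul0r//; ring.
Qed.

Let integrable_u a k k' : - 2^-1 <= a ->
  (@lebesgue_measure R).-integrable setT (EFin \o u a k k').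
Proof.
move=> a2; rewrite uE -restrict_EFin; apply/integrable_restrict => //; rewrite setTI.
rewrite (_ : EFin \o _ = (fun t => ((qjacobi a k * qjacobi a k').[t] * jacobi_weight a t)%:E
  * ((jacobi_h0 a)^-1)%:E)%E)//.
by apply: integrableZr => //; exact: integrable_horner_weight.
Qed.

Let Rintegral_u a k k' : - 2^-1 <= a ->
  \int[@lebesgue_measure R]_t u a k k' t = (k == k')%:R.
Proof.
move=> a2; rewrite uE -Rintegral_mkcond RintegralZr//; last exact: integrable_horner_weight.
rewrite -/(wint _ _) wint_qjacobi// mulrAC divff ?mul1r//.
by rewrite gt_eqF// jacobi_h0_gt0.
Qed.

Lemma jacobi_density_ge0 a d (x : d.-tuple R) : - 2^-1 <= a -> 0 <= jacobi_density a x.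
Proof.
move=> a2; rewrite /jacobi_density !mulr_ge0 ?invr_ge0 ?exprn_ge0 ?(ltW (jacobi_h0_gt0 a2))//.
by apply: prodr_ge0 => i _; exact: jacobi_weight_ge0.
Qed.

Lemma measurable_cube d : measurable (@cube R d).
Proof.
rewrite (_ : @cube R d = \bigcap_(i in [set: 'I_d]) (fun x => tnth x i) @^-1` `[-1, 1]).
  apply: fin_bigcap_measurable => // i _; rewrite -[X in measurable X]setTI.
  by apply: measurable_tnth => //; exact: measurable_itv.
apply/seteqP; split=> [x h i _|x h i] /=; first by rewrite in_itv/=; exact: h.
by have := h i I; rewrite /= in_itv.
Qed.

Lemma measurable_jacobi_density a d : measurable_fun setT (@jacobi_density R d a).
Proof.
apply: measurable_funM; last by apply: measurable_indic; exact: (@measurable_cube d).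
apply: measurable_funM => //; apply: measurable_prod => i _.
apply: measurableT_comp; last exact: measurable_tnth.
exact: (@measurable_jacobi_weight R a setT).
Qed.

Lemma Rintegral_clipped_basis a d (T : measurableType d) (P : probability T R) n
    (X : {RV P >-> n.-tuple R}) (k k' : {ffun 'I_n -> nat}) : - 2^-1 <= a ->
  has_density (lebesgue_tuple n) X (jacobi_density a) ->
  \int[P]_w (clipped_basis a k (X w) * clipped_basis a k' (X w)) = (k == k')%:R.
Proof.
move=> a2 dX.
have bk := bounded_rvM (bounded_clipped_basis a k) (bounded_clipped_basis a k').
transitivity (\int[distribution P X]_x (clipped_basis a k x * clipped_basis a k' x)).
  congr fine; rewrite (@integral_distribution _ _ _ _ _ P X (fun x => (clipped_basis a k x * clipped_basis a k' x)%:E))//.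
    by apply/measurable_EFinP; exact: bk.1.
  apply: (@bounded_rv_integrable _ _ _ P (fun w => clipped_basis a k (X w) * clipped_basis a k' (X w))).
  have [mb [c hc]] := bk; split; last by exists c.
  exact: measurableT_comp mb _.
rewrite (Rintegral_density (fun x => jacobi_density_ge0 x a2) (@measurable_jacobi_density a n) dX bk).
transitivity (\int[lebesgue_tuple n]_x (\prod_l u a (k l) (k' l) (tnth x l))).
  apply: eq_Rintegral => x _.
  have -> : \prod_l u a (k l) (k' l) (tnth x l) = clipped_basis a k x * clipped_basis a k' x *
      ((\prod_l jacobi_weight a (tnth x l)) * \prod_(l < n) (jacobi_h0 a)^-1).
    by rewrite /clipped_basis -!big_split.
  rewrite prodr_const card_ord exprVn /jacobi_density indicE.
  have [_|xc] := boolP (x \in _); first by rewrite mulr1; ring.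
  (* Outside the cube the indicator kills the density, and the clipping kills a factor of the basis
     function. *)
  rewrite !mulr0 (_ : clipped_basis a k x = 0) ?mul0r//.
  have [i xi] : exists i, ~~ (-1 <= tnth x i <= 1).
    apply/existsP; apply: contraNT xc; rewrite negb_exists => /forallP h.
    by rewrite inE => i; have := h i; rewrite negbK.
  rewrite /clipped_basis (bigD1 i)//= /clipped indicE memNset ?mulr0 ?mul0r//=.
  by rewrite in_itv/=; exact/negP.
have [_ ->] := @integral_lebesgue_tuple R n (fun l => u a (k l) (k' l)) (fun l => integrable_u _ _ a2).
under eq_bigr do rewrite Rintegral_u//.
have [->|kk'] := eqVneq k k'; first by rewrite big1// => l _; rewrite eqxx.
have [l kl] : exists l, k l != k' l.
  apply/existsP; apply: contraNT kk'; rewrite negb_exists => /forallP h.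
  by apply/eqP/ffunP => l; apply/eqP; have := h l; rewrite negbK.
by rewrite (bigD1 l)//= (negbTE kl) mul0r.
Qed.
End orthonormality.

(** * The bound for the Gram matrix *)

Lemma cond2_gram_le (R : realType) (d N n m M : nat) (alpha : R)
    (dT : measure_display) (T : measurableType dT) (P : probability T R)
    (X : 'I_n -> {RV P >-> d.-tuple R})
    (e : 'I_M -> {set 'I_d} * {ffun 'I_d -> nat})
    (delta : R) :
  (0 < M)%N -> (0 < N)%N -> (0 < n)%N ->
  - 2^-1 <= alpha ->
  mutually_independent X ->
  (forall p w, cube d (X p w)) ->
  (forall p, has_density (lebesgue_tuple d) (X p) (jacobi_density alpha)) ->
  (forall i, basis_index d N m (e i)) -> injective e ->
  0 < delta -> delta < 1 ->
  ((1 - 2 * M%:R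
      * expR (- (delta ^+ 2 * (n%:R / (3 * Dconst N alpha ^+ (2 * m)
                                       * M%:R)))))%:E
   <= P [set w | (cond2 (gram alpha e (fun p => X p w))
                  <= ((1 + delta) / (1 - delta))%:E)%E])%E.
Proof.
move=> M0 N1 n1 a2 indX cX dX eI einj de0 de1.
have D1 := Dconst_ge1 N1 a2.
pose L := Dconst N alpha ^+ (2 * m) * M%:R.
have L0 : 0 < L by rewrite mulr_gt0 ?ltr0n// exprn_gt0// (lt_le_trans ltr01).
pose phi (i : 'I_M) := clipped_basis alpha (e i).2.
have phiL p w : \sum_i phi i (X p w) ^+ 2 <= L.
  apply: (@le_trans _ _ (\sum_(i < M) Dconst N alpha ^+ (2 * m))).
    by apply: ler_sum => i _; apply: clipped_basis_sqr_le => //; exact: eI.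
  by rewrite sumr_const card_ord -mulr_natr.
have phiE p i j : \int[P]_w (phi i (X p w) * phi j (X p w)) = (i == j)%:R.
  rewrite Rintegral_clipped_basis//; congr _%:R.
  have [->|ij] := eqVneq i j; first by rewrite eqxx.
  apply/eqP; rewrite eqb0; apply: contraNneq ij => E; apply/eqP.
  by apply: einj; exact: basis_index_inj (eI _) (eI _) E.
have bphi i : bounded_rv (phi i) by exact: bounded_clipped_basis.
have gramE w : gram alpha e (fun p => X p w) = n%:R^-1 *: gram_sum X phi n w.
  apply/matrixP => i j; rewrite !mxE summxE mulrAC mulrC; congr (_ * _).
  rewrite mulr_sumr; apply: eq_big => [p|p _]; first by rewrite ltn_ord.
  rewrite mxE big_ord1 !mxE /phi.
  rewrite !(clipped_basisE a2 (eI _) (cX p w)) /Psi.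
  set s := Num.sqrt _.
  (* The factor [jacobi_h0 ^+ d] of a Gram entry is shared equally by its two features. *)
  have s2 : jacobi_h0 alpha ^+ d = s * s.
    by rewrite -expr2 sqr_sqrtr// exprn_ge0// ltW// jacobi_h0_gt0.
  by rewrite s2; ring.
have -> : 3 * Dconst N alpha ^+ (2 * m) * M%:R = 3 * L by rewrite mulrA.
have -> : [set w | (cond2 (gram alpha e (fun p => X p w)) <= ((1 + delta) / (1 - delta))%:E)%E] =
    [set w | (cond2 ((n%:R : R)^-1 *: gram_sum X phi n w) <= ((1 + delta) / (1 - delta))%:E)%E].
  by apply/funext => w /=; rewrite gramE.
exact: matrix_chernoff.
Qed.

Theorem theorem1 (R : realType) (d N n m : nat) (alpha : R)
    (dT : measure_display) (T : measurableType dT) (P : probability T R)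
    (X : 'I_n -> {RV P >-> d.-tuple R})
    (e : 'I_(basis_dim d N m) -> {set 'I_d} * {ffun 'I_d -> nat})
    (delta : R) :
  (1 <= d)%N -> (1 <= N)%N -> (1 <= n)%N ->
  (1 <= m)%N -> (m <= minn d N)%N ->
  - 2^-1 <= alpha ->
  mutually_independent X ->
  (forall p w, cube d (X p w)) ->
  (forall p, has_density (lebesgue_tuple d) (X p) (jacobi_density alpha)) ->
  set_bij [set: 'I_(basis_dim d N m)] (basis_index d N m) e ->
  0 < delta -> delta < 1 ->
  ((1 - 2 * (basis_dim d N m)%:R
      * expR (- (delta ^+ 2 * (n%:R / (3 * Dconst N alpha ^+ (2 * m)
                                       * (basis_dim d N m)%:R)))))%:E
   <= P [set w | (cond2 (gram alpha e (fun p => X p w))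
                  <= ((1 + delta) / (1 - delta))%:E)%E])%E.
Proof.
move=> _ N1 n1 _ _ a2 indX cX dX [eI einj _] de0 de1.
apply: cond2_gram_le => //.
(* The summand [k = 0] equals 1, so the dimension is positive. *)
- by rewrite /basis_dim big_ltn// !bin0.
- by move=> i; exact: eI.
- by move=> i j; apply: einj; rewrite inE.
Qed.
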